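(* Let $P$ be the marginal Metropolis--Hastings kernel with target $\pi$ and proposal $q$, and let $\tilde P$ be the associated pseudo-marginal kernel with weight distributions $\{Q_x\}_{x\in\mathsf X}$. Let $f:\mathsf X\to\mathbb R$ satisfy $\pi(f^2)<\infty$, and write $\operatorname{var}(f,\tilde P)=\operatorname{var}(\tilde f,\tilde P)$ where $\tilde f(x,w)=f(x)$ for all $(x,w)$. (i) Then $\operatorname{var}(f,\tilde P)\ge\operatorname{var}(f,P)$. (ii) More specifically, $$\operatorname{var}(f,\tilde P)\ge \operatorname{var}(f,P)+\liminf_{\lambda\to1-}\bigl[\Delta_{\bar P}(g_\lambda)-\Delta_{\tilde P}(g_\lambda)\bigr],$$ where $g_\lambda(x,y):=[\phi_\lambda(x)-\phi_\lambda(y)]^2$ and $\phi_\lambda(x):=\sum_{k=0}^\infty\lambda^k[P^kf(x)-\pi(f)]$ for $\lambda\in[0,1)$.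
   Context: Let $(\mathsf X,\mathcal B(\mathsf X))$ be a measurable space, $\pi$ a probability measure on it and $q(x,\mathrm dy)$ a Markov kernel on $\mathsf X$. The function $r(x,y)=\frac{\pi(\mathrm dy)q(y,\mathrm dx)}{\pi(\mathrm dx)q(x,\mathrm dy)}$ is the Radon--Nikodym derivative in the sense of Tierney: there is a symmetric measurable set $R\subset\mathsf X^2$ on which the measures $\pi(\mathrm dx)q(x,\mathrm dy)$ and $\pi(\mathrm dy)q(y,\mathrm dx)$ are mutually absolutely continuous, and on whose complement they are mutually singular; on $R$, $r$ is the density of the second with respect to the first, with values in $(0,\infty)$ and $r(x,y)r(y,x)=1$; off $R$, $r:=0$. The marginal kernel is $P(x,\mathrm dy)=\min\{1,r(x,y)\}q(x,\mathrm dy)+\delta_x(\mathrm dy)\rho(x)$ with $\rho(x)=1-\int\min\{1,r(x,y)\}q(x,\mathrm dy)$. Let $\mathsf W$ be a Borel subset of $\mathbb R_+=[0,\infty)$ and let $x\mapsto Q_x$ be a probability kernel from $\mathsf X$ to $\mathsf W$ with $\int w\,Q_x(\mathrm dw)=1$ for all $x$. Put $\pi_x(\mathrm dw)=w\,Q_x(\mathrm dw)$ and $\tilde\pi(\mathrm dx,\mathrm dw)=\pi(\mathrm dx)\pi_x(\mathrm dw)$. The pseudo-marginal kernel is $\tilde P(x,w;\mathrm dy,\mathrm du)=\min\{1,r(x,y)\frac uw\}q(x,\mathrm dy)Q_y(\mathrm du)+\delta_{x,w}(\mathrm dy,\mathrm du)\tilde\rho(x,w)$ with $\tilde\rho(x,w)=1-\iint\min\{1,r(x,y)\frac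 uw\}q(x,\mathrm dy)Q_y(\mathrm du)$; it is reversible with respect to $\tilde\pi$. (If $0\in\mathsf W$, read $\min\{1,r(x,y)u/w\}$ as $1$ for $w=0$; the set $\{w=0\}$ is $\tilde\pi$-null.) For a symmetric measurable $g:\mathsf X^2\to[0,\infty)$, $$\Delta_{\bar P}(g)=\int\tilde\pi(\mathrm dx,\mathrm dw)\int q(x,\mathrm dy)\pi_y(\mathrm du)\min\{1,r(x,y)\}g(x,y),$$ $$\Delta_{\tilde P}(g)=\int\tilde\pi(\mathrm dx,\mathrm dw)\int q(x,\mathrm dy)Q_y(\mathrm du)\min\{1,r(x,y)\tfrac uw\}g(x,y).$$ Asymptotic variance: for a Markov kernel $\Pi$ reversible with respect to a probability $\mu$ on $\mathsf E$, the stationary chain $(X_k)_{k\ge0}$ with kernel $\Pi$ and $X_0\sim\mu$, and $f$ with $\mu(f^2)<\infty$, $\operatorname{var}(f,\Pi):=\lim_{n\to\infty}\frac1n\mathbb E\bigl(\sum_{k=1}^n (f(X_k)-\mu(f))\bigr)^2\in[0,\infty]$ (the limit always exists). *)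

(* Defs.v *)
From HB Require Import structures.
From mathcomp Require Export all_boot all_order all_algebra.
From mathcomp Require Export all_classical all_reals all_analysis.
From mathcomp Require Export measurable_realfun.

Set Implicit Arguments.
Unset Strict Implicit.
Unset Printing Implicit Defensive.

Import Order.TTheory GRing.Theory Num.Theory.
Import numFieldNormedType.Exports.

Local Open Scope classical_set_scope.
Local Open Scope ring_scope.
Local Open Scope ereal_scope.

Lemma measurable_kernel_xsection d d' (X : measurableType d)
    (Y : measurableType d') (R : realType) (k : R.-pker X ~> Y)
    (A : set (X * Y)) : measurable A ->
  measurable_fun [set: X] (fun x => k x (xsection A x)).
Proof.
move=> mA.
rewrite [X in measurable_fun _ X](_ : _ =
    (fun x => \int[k x]_y (\1_A (x, y))%:E)); last first.
  apply/funext => x; rewrite integral_indic//.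
    by rewrite setIT xsectionE.
  by rewrite -[X in measurable X]xsectionE; exact: measurable_xsection.
apply: (measurable_fun_integral_finite_kernel (fun p => (\1_A p)%:E) k) => //.
by apply/measurable_EFinP; exact: measurable_indic.
Qed.

Section joint_measure.
Context d d' (X : measurableType d) (Y : measurableType d') (R : realType).
Variables (mu : {measure set X -> \bar R}) (k : R.-pker X ~> Y).

(* mu(dx) k(x, dy) *)
Definition mjoint (A : set (X * Y)) : \bar R :=
  \int[mu]_x k x (xsection A x).

Let mjoint0 : mjoint set0 = 0.
Proof. by apply: integral0_eq => x _; rewrite xsection0 measure0. Qed.

Let mjoint_ge0 A : 0 <= mjoint A.
Proof. exact: integral_ge0. Qed.

Let mjoint_additive : semi_sigma_additive mjoint.
Proof.
move=> F mF tF mUF.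
have -> : mjoint (\bigcup_n F n) = \sum_(n <oo) mjoint (F n).
  rewrite /mjoint -integral_nneseries//; last first.
    by move=> n; exact: measurable_kernel_xsection.
  apply: eq_integral => x _; rewrite xsection_bigcup.
  rewrite measure_semi_bigcup//.
  - by move=> n; exact: measurable_xsection.
  - exact: trivIset_xsection.
  - by apply: bigcup_measurable => n _; exact: measurable_xsection.
by apply: is_cvg_ereal_nneg_natsum => n _; exact: mjoint_ge0.
Qed.

HB.instance Definition _ := isMeasure.Build _ _ _ mjoint
  mjoint0 mjoint_ge0 mjoint_additive.

End joint_measure.

Section joint_probability.
Context d d' (X : measurableType d) (Y : measurableType d') (R : realType).
Variables (mu : probability X R) (k : R.-pker X ~> Y).

Definition pjoint : set (X * Y) -> \bar R := mjoint mu k.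

HB.instance Definition _ := Measure.on pjoint.

Let pjoint_setT : pjoint setT = 1.
Proof.
rewrite /pjoint /mjoint.
under eq_integral.
  move=> x _; rewrite (_ : xsection setT x = setT) ?prob_kernel; last first.
    by rewrite -subTset => y _; rewrite /xsection/= inE.
  over.
by rewrite integral_cst// mul1e; exact: probability_setT.
Qed.

HB.instance Definition _ := Measure_isProbability.Build _ _ _ pjoint pjoint_setT.

End joint_probability.

(* The measures mu(dx)q(x,dy) and mu(dy)q(y,dx) on X * X are [mjoint mu q] and
   its image under the exchange of coordinates.  A function [r] is a version of
   their Radon-Nikodym ratio when, for some symmetric measurable [S], they are
   mutually absolutely continuous on [S] with density [r] there, mutually
   singular off [S], and [r] has the normalization required on and off [S]. *)
Definition tierney_ratio d (X : measurableType d) (R : realType)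
    (mu : probability X R) (q : R.-pker X ~> X) (r : X * X -> R) : Prop :=
  let fwd : {measure set (X * X) -> \bar R} := mjoint mu q in
  let bwd := fun A : set (X * X) => fwd [set p | A (p.2, p.1)] in
  measurable_fun setT r /\
  exists S : set (X * X),
    [/\ measurable S,
        (forall x y, S (x, y) -> S (y, x)),
        (forall A, measurable A -> A `<=` S -> (fwd A = 0 <-> bwd A = 0)),
        (exists B, [/\ measurable B, B `<=` ~` S, fwd B = 0 &
                       bwd (~` S `\` B) = 0]) &
        [/\ (forall A, measurable A -> A `<=` S ->
              bwd A = \int[fwd]_(p in A) (r p)%:E),
            (forall p, S p -> (0 < r p)%R),
            (forall x y, S (x, y) -> (r (x, y) * r (y, x) = 1)%R) &
            (forall p, ~ S p -> r p = 0%R)]].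

Lemma tierney_ratio_measurable d (X : measurableType d) (R : realType)
    (mu : probability X R) (q : R.-pker X ~> X) (r : X * X -> R) :
  tierney_ratio mu q r -> measurable_fun setT r.
Proof. by case. Qed.

Lemma tierney_ratio_ge0 d (X : measurableType d) (R : realType)
    (mu : probability X R) (q : R.-pker X ~> X) (r : X * X -> R) :
  tierney_ratio mu q r -> forall p, (0 <= r p)%R.
Proof.
move=> [_ [S [_ _ _ _ [_ r0 _ r0']]]] p.
by have [/r0/ltW//|/r0' ->] := pselect (S p).
Qed.

Section metropolis_hastings_kernel.
Context d (E : measurableType d) (R : realType).
Variables (k : R.-pker E ~> E) (a : E * E -> R).
Hypotheses (ma : measurable_fun setT a)
  (a01 : forall p, (0 <= a p <= 1)%R).

(* propose from k(x, dy), accept with probability a(x, y), else stay at x: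
   a(x, y) k(x, dy) + (1 - \int a(x, y) k(x, dy)) \delta_x(dy);
   [ma] and [a01] are arguments because they make this a probability kernel *)
Definition mh_set
    of measurable_fun setT a & (forall p, (0 <= a p <= 1)%R) :=
  fun (x : E) (A : set E) =>
    \int[k x]_(y in A) (a (x, y))%:E
    + (1 - \int[k x]_y (a (x, y))%:E) * \d_x A.

Local Notation K := (mh_set ma a01).

Let max x : measurable_fun setT (fun y => (a (x, y))%:E).
Proof. by apply/measurable_EFinP; exact: measurableT_comp. Qed.

Let ax0 x y : 0 <= (a (x, y))%:E.
Proof. by rewrite lee_fin; case/andP: (a01 (x, y)). Qed.

Let iax1 x : \int[k x]_y (a (x, y))%:E <= 1.
Proof.
rewrite -(@prob_kernel _ _ _ _ _ k x) -[leRHS]mul1e -integral_cst//.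
apply: ge0_le_integral => //.
by move=> y _; rewrite lee_fin; case/andP: (a01 (x, y)).
Qed.

Let iax_fin x : \int[k x]_y (a (x, y))%:E \is a fin_num.
Proof.
by rewrite ge0_fin_numE ?integral_ge0// (le_lt_trans (iax1 x))// ltry.
Qed.

Let rho_ge0 x : 0 <= 1 - \int[k x]_y (a (x, y))%:E.
Proof. by rewrite sube_ge0 ?iax_fin ?orbT. Qed.

Let K0 x : K x set0 = 0.
Proof. by rewrite /mh_set integral_set0 measure0 mule0 adde0. Qed.

Let K_ge0 x A : 0 <= K x A.
Proof.
by apply: adde_ge0; [exact: integral_ge0|apply: mule_ge0].
Qed.

Let K_additive x : semi_sigma_additive (K x).
Proof.
have -> : K x = (fun A => \int[k x]_(y in A) (a (x, y))%:E) \+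
    mscale (NngNum (fine_ge0 (rho_ge0 x))) \d_x.
  apply/funext => A; rewrite /mh_set /= /mscale /= fineK//.
  by rewrite fin_numB iax_fin.
move=> F mF tF mUF.
rewrite [X in X @ _ --> _](_ : _ =
  (fun n => \sum_(0 <= i < n) \int[k x]_(y in F i) (a (x, y))%:E) \+
  (fun n => \sum_(0 <= i < n)
     mscale (NngNum (fine_ge0 (rho_ge0 x))) \d_x (F i))); last first.
  by apply/funext => n; rewrite /= -big_split.
apply: cvgeD.
- by apply: ge0_adde_def; rewrite inE; [exact: integral_ge0|exact: measure_ge0].
- exact: semi_sigma_additive_nng_induced.
- exact: measure_semi_sigma_additive.
Qed.

HB.instance Definition _ x := isMeasure.Build _ _ _ (K x)
  (K0 x) (K_ge0 x) (@K_additive x).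

Definition mh_kernel : E -> {measure set E -> \bar R} := K.

Let measurable_iax A : measurable A ->
  measurable_fun setT (fun x => \int[k x]_(y in A) (a (x, y))%:E).
Proof.
move=> mA.
rewrite [X in measurable_fun _ X](_ : _ = (fun x => \int[k x]_y
    ((EFin \o a) \_ (setT `*` A)) (x, y))); last first.
  apply/funext => x; rewrite integral_mkcond.
  apply: eq_integral => y _; rewrite !patchE.
  by congr (if _ then _ else _); rewrite in_setX in_setT.
apply: (measurable_fun_integral_finite_kernel _ k).
  by move=> p; rewrite patchE; case: ifPn => // _; case: p.
apply/(measurable_restrictT _ _).1; first exact: measurableX.
by apply: measurable_funTS; exact/measurable_EFinP.
Qed.

Let measurable_K A : measurable A -> measurable_fun setT (K ^~ A).
Proof.
move=> mA; apply: emeasurable_funD; first exact: measurable_iax.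
apply: emeasurable_funM.
  by apply: emeasurable_funB => //; exact: measurable_iax.
by apply/measurable_EFinP; exact: measurable_indic.
Qed.

HB.instance Definition _ := isKernel.Build _ _ _ _ _ mh_kernel measurable_K.

Let K_setT x : K x setT = 1.
Proof.
by rewrite /mh_set diracT mule1 addeC subeK// iax_fin.
Qed.

HB.instance Definition _ := Kernel_isProbability.Build _ _ _ _ _ mh_kernel K_setT.

End metropolis_hastings_kernel.

Section weight_space.
Variable R : realType.

(* a Borel subset of [0, +oo[; it is required to be nonempty only because
   measurable types are inhabited, and no probability kernel into the empty set
   exists *)
Record weight_set := WeightSet {
  wset :> set R;
  wset_measurable : measurable wset;
  wset_ge0 : forall w, wset w -> (0 <= w)%R;
  wset_nonempty : wset !=set0 }.

Variable W : weight_set.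

Definition weight_carrier : Type := {w : R | w \in wset W}.

HB.instance Definition _ := Choice.on weight_carrier.

Let weight_point : weight_carrier :=
  exist _ (projT1 (cid (wset_nonempty W)))
    (mem_set (projT2 (cid (wset_nonempty W)))).

HB.instance Definition _ := isPointed.Build weight_carrier weight_point.

Definition weight_val (w : weight_carrier) : R := val w.

(* the sigma-algebra is the trace of the Borel sets of R *)
Definition weight : Type := g_sigma_algebra_preimageType weight_val.

HB.instance Definition _ := Measurable.on weight.

Definition wval (w : weight) : R := weight_val w.

Lemma measurable_wval : measurable_fun setT wval.
Proof. by move=> _ B mB; exists B. Qed.

Lemma wval_ge0 w : (0 <= wval w)%R.
Proof. by apply: (@wset_ge0 W); apply: set_mem; exact: (valP w). Qed.

End weight_space.
Arguments wval {R W} w.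

Section weighted_kernel.
Context d (X : measurableType d) (R : realType) (W : weight_set R).
Variable Q : R.-pker X ~> weight W.
Hypothesis Q1 : forall x, \int[Q x]_w (wval w)%:E = 1.

Let mwval : measurable_fun setT (fun w : weight W => (wval w)%:E).
Proof. by apply/measurable_EFinP; exact: measurable_wval. Qed.

Let wval0 (w : weight W) : 0 <= (wval w)%:E.
Proof. by rewrite lee_fin wval_ge0. Qed.

(* pi_x(dw) = w Q_x(dw) *)
Definition weighted_set of (forall x, \int[Q x]_w (wval w)%:E = 1) :=
  fun (x : X) (A : set (weight W)) => \int[Q x]_(w in A) (wval w)%:E.

Local Notation K := (weighted_set Q1).

Let K0 x : K x set0 = 0.
Proof. by rewrite /weighted_set integral_set0. Qed.

Let K_ge0 x A : 0 <= K x A.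
Proof. exact: integral_ge0. Qed.

Let K_additive x : semi_sigma_additive (K x).
Proof. exact: semi_sigma_additive_nng_induced. Qed.

HB.instance Definition _ x := isMeasure.Build _ _ _ (K x)
  (K0 x) (K_ge0 x) (@K_additive x).

Definition weighted_kernel : X -> {measure set (weight W) -> \bar R} := K.

Let measurable_K A : measurable A -> measurable_fun setT (K ^~ A).
Proof.
move=> mA; rewrite /weighted_set; under eq_fun do rewrite integral_mkcond.
apply: measurable_fun_integral_kernel.
- exact: measurable_kernel.
- by move=> w; rewrite patchE; case: ifPn.
- by apply/(measurable_restrictT _ _).1 => //; exact: measurable_funTS.
Qed.

HB.instance Definition _ :=
  isKernel.Build _ _ _ _ _ weighted_kernel measurable_K.

HB.instance Definition _ :=
  Kernel_isProbability.Build _ _ _ _ _ weighted_kernel Q1.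

End weighted_kernel.

Section pseudo_marginal_proposal.
Context d d' (X : measurableType d) (U : measurableType d') (R : realType).
Variables (q : R.-pker X ~> X) (Q : R.-pker X ~> U).

(* q(x, dy) Q_y(du), as a kernel on X * U *)
Definition pm_proposal (z : X * U) : {measure set (X * U) -> \bar R} :=
  mjoint (q z.1) Q.

Let measurable_pm_proposal A : measurable A ->
  measurable_fun setT (pm_proposal ^~ A).
Proof.
move=> mA; rewrite /pm_proposal /= /mjoint.
apply: (@measurableT_comp _ _ _ _ _ _
  (fun x => \int[q x]_y Q y (xsection A y)) _ fst) => //.
apply: measurable_fun_integral_kernel => //.
- exact: measurable_kernel.
- exact: measurable_kernel_xsection.
Qed.

HB.instance Definition _ :=
  isKernel.Build _ _ _ _ _ pm_proposal measurable_pm_proposal.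

Let pm_proposal_setT z : pm_proposal z setT = 1.
Proof.
rewrite /pm_proposal /= /mjoint -(@prob_kernel _ _ _ _ _ q z.1).
rewrite -[RHS]mul1e -integral_cst//; apply: eq_integral => y _ /=.
rewrite -(@prob_kernel _ _ _ _ _ Q y); congr (Q y _).
by rewrite -subTset => u _; rewrite /xsection/= inE.
Qed.

HB.instance Definition _ :=
  Kernel_isProbability.Build _ _ _ _ _ pm_proposal pm_proposal_setT.

End pseudo_marginal_proposal.

Section acceptance.
Context d (X : measurableType d) (R : realType).
Variables (r : X * X -> R) (W : weight_set R).
Local Open Scope ring_scope.

Definition marginal_acc (p : X * X) : R := Num.min 1 (r p).

(* min {1, r(x, y) u / w}, read as 1 when w = 0 *)
Definition pm_acc (p : (X * weight W) * (X * weight W)) : R :=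
  if wval p.1.2 == 0 then 1
  else Num.min 1 (r (p.1.1, p.2.1) * (wval p.2.2 / wval p.1.2)).

Hypotheses (mr : measurable_fun setT r) (r0 : forall p, 0 <= r p).

Lemma measurable_marginal_acc : measurable_fun setT marginal_acc.
Proof. exact: measurable_minr. Qed.

Lemma marginal_acc01 p : 0 <= marginal_acc p <= 1.
Proof. by rewrite /marginal_acc le_min ler01 r0/= ge_min lexx. Qed.

Lemma measurable_pm_acc : measurable_fun setT pm_acc.
Proof.
have mw1 : measurable_fun setT
    (fun p : (X * weight W) * (X * weight W) => wval p.1.2).
  apply: (@measurableT_comp _ _ _ _ _ _ (@wval R W)).
    exact: measurable_wval.
  exact: measurableT_comp.
have mw2 : measurable_fun setT
    (fun p : (X * weight W) * (X * weight W) => wval p.2.2).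
  apply: (@measurableT_comp _ _ _ _ _ _ (@wval R W)).
    exact: measurable_wval.
  exact: measurableT_comp.
apply: measurable_fun_ifT => //.
  exact: measurable_fun_eqr.
apply: measurable_minr => //; apply: measurable_funM.
  apply: measurableT_comp => //; apply: measurable_fun_pair.
    exact: measurableT_comp.
  exact: measurableT_comp.
apply: measurable_funM => //.
under eq_fun do rewrite -(powR_inv1 (wval_ge0 _)).
by apply: (measurableT_comp (measurable_powR _)).
Qed.

Lemma pm_acc01 p : 0 <= pm_acc p <= 1.
Proof.
rewrite /pm_acc; case: ifPn => _; first by rewrite ler01 lexx.
by rewrite le_min ler01 ge_min lexx/= andbT mulr_ge0// divr_ge0// wval_ge0.
Qed.

End acceptance.

Section kernels.
Context d (X : measurableType d) (R : realType) (mu : probability X R).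
Variables (q : R.-pker X ~> X) (r : X * X -> R).
Hypothesis hr : tierney_ratio mu q r.

Definition marginal_kernel : R.-pker X ~> X :=
  mh_kernel q (measurable_marginal_acc (tierney_ratio_measurable hr))
    (marginal_acc01 (tierney_ratio_ge0 hr)).

Variables (W : weight_set R) (Q : R.-pker X ~> weight W).

Definition pseudo_marginal_kernel : 
    R.-pker (X * weight W)%type ~> (X * weight W)%type :=
  mh_kernel (pm_proposal q Q)
    (measurable_pm_acc (W := W) (tierney_ratio_measurable hr))
    (pm_acc01 (W := W) (tierney_ratio_ge0 hr)).

Hypothesis Q1 : forall x, \int[Q x]_w (wval w)%:E = 1.

Definition pm_target : probability (X * weight W)%type R :=
  pjoint mu (weighted_kernel Q1).

Definition Delta_bar (g : X -> X -> R) : \bar R :=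
  \int[pm_target]_z \int[pm_proposal q (weighted_kernel Q1) z]_z'
    (marginal_acc r (z.1, z'.1) * g z.1 z'.1)%:E.

Definition Delta_tilde (g : X -> X -> R) : \bar R :=
  \int[pm_target]_z \int[pm_proposal q Q z]_z'
    (pm_acc r (z, z') * g z.1 z'.1)%:E.

End kernels.

Section markov_chain.
Context d (E : measurableType d) (R : realType).
Variable K : R.-pker E ~> E.

(* E_x[F(X_1, .., X_n)] for the Markov chain (X_k) with kernel K and X_0 = x,
   as the iterated integral of F against
   K(x, dx_1) K(x_1, dx_2) .. K(x_(n-1), dx_n) *)
Fixpoint path_expectation (n : nat) (F : seq E -> \bar R) (x : E) : \bar R :=
  if n is m.+1 then
    \int[K x]_y path_expectation m (fun s => F (y :: s)) y
  else F [::].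

(* lim_n n^-1 E[(\sum_(1 <= k <= n) (f(X_k) - mu(f)))^2] with X_0 ~ mu *)
Definition asymptotic_variance (mu : probability E R) (f : E -> R) : \bar R :=
  let m := (\int[mu]_x f x)%R in
  limn (fun n => (n%:R^-1)%:E *
    \int[mu]_x path_expectation n
      (fun s => ((\sum_(y <- s) (f y - m)) ^+ 2)%:E) x).

(* [Rintegral] gives K f(x) the value 0 at the points x where \int K(x, dy) f(y)
   is infinite or undefined; they form a null set when f is
   integrable for an invariant probability of K *)
Definition kernel_op (f : E -> R) : E -> R := fun x => (\int[K x]_y f y)%R.

(* \sum_(k >= 0) l^k (K^k f - mu(f)) *)
Definition resolvent_sum (mu : probability E R) (f : E -> R) (l : R) : E -> R :=
  fun x => limn (series (fun k =>
    (l ^+ k * (iter k kernel_op f x - \int[mu]_y f y))%R)).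

End markov_chain.

(* Main.v *)
Require Import Defs.
From HB Require Import structures.
From mathcomp Require Import all_boot all_order all_algebra.
From mathcomp Require Import all_classical all_reals all_analysis.
From mathcomp Require Import ring lra.

(** Let [K] be a kernel reversible with respect to [nu], write [<., .>] for the
    inner product of L2(nu), [e_k = K^k f - nu(f)] and [c_k = <e_0, e_k>].  For
    [0 < l < 1] let [C_l = \sum_k l^k c_k], which is [<e_0, (I - l K)^-1 e_0>].

    The asymptotic variance is the limit of [n^-1 V_n], where [V_n] is the variance
    of a sum of [n] consecutive terms ([integral_path_expectation]).  Reversibility
    makes [c_(2k) + 2 c_(2k+1) + c_(2k+2)] a squared norm, so that [n^-1 V_n] differs
    from a nondecreasing sequence by a quantity of order [n^-1]; hence the limit
    exists, possibly infinite ([cvg_partial_variance]).  The Abel means [2 C_l - c_0]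
    then tend to the same limit as [l] tends to 1, by summation by parts
    ([abel_sum_ge], [abel_sum_le]).

    For fixed [l], [C_l] is the supremum over [g] in L2(nu) of
    [2 <e_0, g> - <g, (I - l K) g>], attained at the resolvent
    [phi = \sum_k l^k e_k] ([abel_sum_ge_variational], [abel_sum_le_resolvent]), and
    [<g, (I - l K) g> = (1 - l) |g|^2 + (l / 2) E_K(g)], where [E_K(g)] is the
    Dirichlet form, the integral of [(g(x) - g(y))^2] against [nu(dx) K(x, dy)].
    Take for [g] the resolvent of the marginal kernel [P], lifted to weighted states:
    its linear and norm terms do not see the weights, so
    [C_l] of the pseudo-marginal kernel is at least [C_l] of [P] plus [l / 2] times
    the difference of the two Dirichlet forms of [phi]
    ([asymptotic_variance_abel_gap]).

    The Dirichlet forms are [Delta_bar] and [Delta_tilde] at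
    [g_l(x, y) = (phi(x) - phi(y))^2].  The difference is nonnegative because the
    mean of [min(w, r u)] over independent weights of mean 1 is at most
    [min(1, r)] ([weight_average_le], [Delta_tilde_le]).  Letting [l] tend to 1 gives
    both inequalities. *)

Set Implicit Arguments.
Unset Strict Implicit.
Unset Printing Implicit Defensive.

Import Order.TTheory GRing.Theory Num.Theory.
Import numFieldNormedType.Exports.

Local Open Scope classical_set_scope.
Local Open Scope ring_scope.

(** * Pointwise limits of measurable functions *)

Lemma cvgn_cauchyP (R : realType) (u : nat -> R) : cvgn u <->
  forall k, exists N, forall n, `|u (N + n)%N - u N| <= k.+1%:R^-1.
Proof.
split.
- move=> /cvg_ex[x /cvgrPdist_lt uc] k.
  have k0 : 0 < (k.+1%:R^-1 / 2 : R) by [].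
  have [N _ Nx] := uc _ k0.
  exists N => n; have := Nx N (leqnn N); have := Nx (N + n)%N (leq_addr _ _).
  move=> /= H1 H2.
  have -> : u (N + n)%N - u N = (x - u N) - (x - u (N + n)%N) by ring.
  by rewrite (le_trans (ler_normB _ _))// [leRHS]splitr lerD// ltW.
- move=> uc; apply/cauchy_cvgP/cauchy_exP => _/posnumP[e].
  have [k _ /(_ k (leqnn k)) /= ke] := near_infty_natSinv_lt e.
  have [N uN] := uc k; exists (u N), N => // n Nn.
  by rewrite /ball/= distrC -(subnKC Nn) (le_lt_trans (uN _)).
Qed.

(** The resolvent is defined as a limit at every point, including those where
    the series diverges and [limn] returns a default value.  It is nevertheless
    measurable, because the Cauchy criterion describes the set of convergence by
    countably many conditions. *)
Lemma measurable_limn d (T : measurableType d) (R : realType)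
    (h : nat -> T -> R) : (forall n, measurable_fun setT (h n)) ->
  measurable_fun setT (fun x => limn (h ^~ x)).
Proof.
move=> mh; pose D := [set x | cvgn (h ^~ x)].
have mD : measurable D.
  have -> : D = \bigcap_k \bigcup_N \bigcap_n
      [set x | `|h (N + n)%N x - h N x| <= k.+1%:R^-1].
    apply/seteqP; split => x /=.
      move=> /cvgn_cauchyP hx k _; have [N hN] := hx k.
      by exists N => // n _; exact: hN.
    move=> hx; apply/cvgn_cauchyP => k; have [N _ hN] := hx k I.
    by exists N => n; exact: hN.
  apply: bigcapT_measurable => k; apply: bigcupT_measurable => N.
  apply: bigcapT_measurable => n.
  have mn : measurable_fun setT (fun x => `|h (N + n)%N x - h N x|).
    by apply: measurableT_comp => //; exact: measurable_funB.
  rewrite -[X in measurable X]setTI.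
  have := mn measurableT _ (measurable_itv `]-oo, (k.+1%:R^-1 : R)]).
  by congr (measurable (_ `&` _)); apply/seteqP; split => x /=; rewrite in_itv.
(* [limn] equals [point] off D *)
apply: (measurable_fun_cvg
  (h := fun n x => if x \in D then h n x else (point : R))) => [n|x _].
  apply: measurable_fun_ifT => //; apply: (measurable_fun_bool true).
  rewrite setTI (_ : _ @^-1` _ = D)//.
  by apply/seteqP; split => x; [move=> /set_mem|move=> /mem_set].
have [xD|xD] := boolP (x \in D); first exact: set_mem xD.
rewrite dvgP; first exact: cvg_cst.
by move=> cx; case/negP: xD; exact: mem_set.
Qed.

(** * Cesaro and Abel means of autocovariances *)

Section autocovariances.
Variables (R : realType).
Implicit Types (c : nat -> R) (a B K l : R).

(** The sum of [c `|k|] over all integers [k] with [`|k| <= j]. *)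
Definition two_sided_sum c (j : nat) : R := c 0 + 2 * \sum_(k < j) c k.+1.

(** For a stationary sequence with autocovariances [c], this is the variance of
    the sum of [n] consecutive terms. *)
Definition partial_variance c (n : nat) : R := \sum_(j < n) two_sided_sum c j.

Lemma two_sided_sumS c j :
  two_sided_sum c j.+1 = two_sided_sum c j + 2 * c j.+1.
Proof. by rewrite /two_sided_sum big_ord_recr/=; ring. Qed.

Lemma partial_varianceS c n :
  partial_variance c n.+1 = partial_variance c n + two_sided_sum c n.
Proof. by rewrite /partial_variance big_ord_recr. Qed.

Lemma partial_variance0 c : partial_variance c 0 = 0.
Proof. by rewrite /partial_variance big_ord0. Qed.

(** The two-sided sums of a reversible chain need not be monotone, nor converge:
    an eigenvalue -1 makes them oscillate.  The correction below removes the
    oscillation, and its own partial sums telescope to a bounded quantity, so that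
    it does not affect Cesaro means. *)
Definition smoothed_sum c (j : nat) : R :=
  two_sided_sum c j + (if odd j then c j.+1 else - c j).

Lemma smoothed_sum_nondecreasing c :
  (forall k, 0 <= c k.*2 + 2 * c k.*2.+1 + c k.*2.+2) ->
  forall j, smoothed_sum c j <= smoothed_sum c j.+1.
Proof.
move=> cpair j; rewrite /smoothed_sum two_sided_sumS/=.
have [oj|ej] := boolP (odd j) => /=; first lra.
have := cpair j./2; have -> : j./2.*2 = j by rewrite even_halfK.
lra.
Qed.

Lemma sum_smoothed_sum c n : \sum_(j < n) smoothed_sum c j =
  partial_variance c n - c 0 + (if odd n then 0 else c n).
Proof.
elim: n => [|n IH]; first by rewrite big_ord0 partial_variance0/=; ring.
rewrite big_ord_recr/= IH partial_varianceS /smoothed_sum.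
by case: (odd n) => /=; ring.
Qed.

Lemma cvg_natV : (fun n : nat => n%:R^-1 : R) @ \oo --> (0 : R).
Proof. by rewrite -cvg_shiftS; exact: cvg_harmonic. Qed.

Lemma mean_nondecreasing (w : nat -> R) : 0 <= w 0 ->
  (forall j, w j <= w j.+1) ->
  {homo (fun n => n%:R^-1 * \sum_(j < n) w j) : m n / (m <= n)%N >-> m <= n}.
Proof.
move=> w0 wS; have wnd : {homo w : m n / (m <= n)%N >-> m <= n}.
  by apply: homo_leq => //; exact: le_trans.
apply: homo_leq => [x|y x z|n]; [exact: lexx|exact: le_trans|].
case: n => [|n].
  by rewrite big_ord0 mulr0 mulr_ge0// big_ord_recr big_ord0/= add0r.
rewrite [in leRHS]big_ord_recr/= mulrDr -lerBlDl.
have H : \sum_(j < n.+1) w j <= n.+1%:R * w n.+1.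
  have -> : n.+1%:R * w n.+1 = \sum_(j < n.+1) w n.+1.
    by rewrite sumr_const card_ord mulr_natl.
  by apply: ler_sum => i _; apply: wnd; exact: ltnW.
have n1 : n.+1%:R > 0 :> R by [].
have n2 : n.+1%:R + 1 > 0 :> R by rewrite natr1.
rewrite -(natr1 n.+1); move: n1 n2 H.
set S := \sum_(_ < _) _; move: (n.+1%:R) S (w n.+1) => x S v x0 x1 H.
rewrite -(ler_pM2l x0) -(ler_pM2l x1).
have -> : (x + 1) * (x * (x^-1 * S - (x + 1)^-1 * S)) = S.
  by field; rewrite !gt_eqF.
by have -> : (x + 1) * (x * ((x + 1)^-1 * v)) = x * v by field; rewrite !gt_eqF.
Qed.

(** Up to a term of order [n^-1], the quotient is the Cesaro mean of the
    nondecreasing sequence [smoothed_sum c], and such means are nondecreasing. *)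
Lemma cvg_partial_variance c B : (forall k, `|c k| <= B) ->
  (forall k, 0 <= c k.*2 + 2 * c k.*2.+1 + c k.*2.+2) ->
  cvgn (fun n => (n%:R^-1 * partial_variance c n)%:E).
Proof.
move=> cB cpair.
pose a n := n%:R^-1 * \sum_(j < n) smoothed_sum c j : R.
pose e n := n%:R^-1 * (c 0 - (if odd n then 0 else c n)) : R.
have -> : (fun n => (n%:R^-1 * partial_variance c n)%:E) =
    (fun n => (a n)%:E + (e n)%:E)%E.
  apply/funext => n; rewrite -EFinD /a /e sum_smoothed_sum; congr EFin; ring.
have e0 : e @ \oo --> (0 : R).
  apply: (@squeeze_cvgr _ _ _ _ (fun n => - (n%:R^-1 * (B + B)))
     (fun n => n%:R^-1 * (B + B))).
  - apply: nearW => n; rewrite -ler_norml /e normrM ger0_norm ?invr_ge0//.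
    rewrite ler_wpM2l ?invr_ge0// (le_trans (ler_normB _ _))// lerD//.
    by case: ifPn; rewrite ?normr0// (le_trans _ (cB 0)).
  - rewrite -oppr0; apply: cvgN; rewrite -(mul0r (B + B)); apply: cvgMl.
    exact: cvg_natV.
  - rewrite -(mul0r (B + B)); apply: cvgMl; exact: cvg_natV.
have acv : cvgn (fun n => (a n)%:E).
  apply: ereal_nondecreasing_is_cvgn => m n mn; rewrite lee_fin.
  apply: mean_nondecreasing => //; last exact: smoothed_sum_nondecreasing.
  by rewrite /smoothed_sum /two_sided_sum big_ord0/=; lra.
have ecv : (fun n => (e n)%:E) @ \oo --> 0%E.
  by apply: cvg_EFin => //; exact: nearW.
apply: is_cvgeD => //; last by apply/cvg_ex; exists 0%E.
by rewrite (cvg_lim _ ecv)// fin_num_adde_defl.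
Qed.

Definition abel_sum c (l : R) : R := limn (series (fun k => l ^+ k * c k)).

Lemma cvg_abel_sum c B l : (forall k, `|c k| <= B) -> 0 < l < 1 ->
  series (fun k => l ^+ k * c k) @ \oo --> abel_sum c l.
Proof.
move=> cB /andP[l0 l1]; apply: normed_cvg.
apply: (@series_le_cvg _ _ (geometric B l)) => [n|n|n|] /=.
- exact: normr_ge0.
- by rewrite mulr_ge0 ?exprn_ge0 ?(ltW l0)// (le_trans _ (cB 0)).
- by rewrite normrM normrX (gtr0_norm l0) mulrC ler_wpM2r// exprn_ge0// ltW.
- by apply: is_cvg_geometric_series; rewrite gtr0_norm.
Qed.

Lemma sum_by_parts (x : nat -> R) l N :
  (1 - l) * (\sum_(n < N) l ^+ n * \sum_(j < n.+1) x j) =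
  \sum_(n < N) l ^+ n * x n - l ^+ N * \sum_(j < N) x j.
Proof.
elim: N => [|N IH]; first by rewrite !big_ord0; ring.
rewrite big_ord_recr/= mulrDr IH [in RHS]big_ord_recr/=.
by rewrite !(big_ord_recr N) /= exprS; ring.
Qed.

Lemma natX_bounded (l : R) n : 0 < l < 1 -> n.+1%:R * l ^+ n <= (1 - l)^-1.
Proof.
move=> /andP[l0 l1]; have := @geometric_le_lim _ n.+1 1 l ler01 l0.
rewrite gtr0_norm// mul1r => /(_ l1); apply: le_trans.
rewrite /series/= big_mkord.
have -> : n.+1%:R * l ^+ n = \sum_(k < n.+1) l ^+ n.
  by rewrite sumr_const card_ord mulr_natl.
apply: ler_sum => k _; rewrite mul1r.
by rewrite ler_wiXn2l ?ltW// -ltnS.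
Qed.

Lemma cvg_natX2 (l : R) : 0 < l < 1 ->
  (fun n => n.+1%:R ^+ 2 * l ^+ n) @ \oo --> 0.
Proof.
move=> /andP[l0 l1].
(* l = m ^ 4, of which m ^ 2 absorbs the square of n and m ^ 2 is left over *)
pose m := Num.sqrt (Num.sqrt l).
have m0 : 0 < m by rewrite !sqrtr_gt0.
have m1 : m < 1 by rewrite /m -sqrtr1 ltr_sqrt// -[ltRHS]sqrtr1 ltr_sqrt.
have lm : l = (m * m) * (m * m).
  by rewrite -!expr2 sqr_sqrtr ?sqrtr_ge0// sqr_sqrtr// ltW.
apply: (@squeeze_cvgr _ _ _ _ (cst 0)
    (fun n => ((1 - m)^-1 ^+ 2) * (m * m) ^+ n)).
- apply: nearW => n; rewrite mulr_ge0 ?exprn_ge0 ?(ltW l0)//=.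
  have -> : n.+1%:R ^+ 2 * l ^+ n = (n.+1%:R * m ^+ n) ^+ 2 * (m * m) ^+ n.
    by rewrite lm !exprMn; ring.
  rewrite ler_wpM2r ?exprn_ge0 ?mulr_ge0 ?(ltW m0)//.
  rewrite lerXn2r ?nnegrE ?mulr_ge0 ?exprn_ge0 ?(ltW m0) ?invr_ge0 //
    ?subr_ge0 ?(ltW m1)//.
  by rewrite natX_bounded// m0.
- exact: cvg_cst.
- apply: (@cvg_geometric _ ((1 - m)^-1 ^+ 2) (m * m)).
  by rewrite gtr0_norm ?mulr_gt0// mulr_ilt1// ltW.
Qed.

(** Two summations by parts express [2 * abel_sum c l - c 0] as the weighted
    average [(1 - l)^2 \sum_n l^n V_(n+1)] of [V = partial_variance c]; the same
    average of the sequence [n] is 1.  Hence a linear minorant of [V] with slope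
    [a] gives the lower bound [a], up to an error that vanishes as [l] tends
    to 1. *)
Lemma abel_sum_ge c B l a K : (forall k, `|c k| <= B) -> 0 < l < 1 ->
  (forall n, a * n%:R - K <= partial_variance c n) ->
  a - (1 - l) * K <= 2 * abel_sum c l - c 0.
Proof.
move=> cB l01 Va; have /andP[l0 l1] := l01.
(* the second differences of partial_variance c n - a * n *)
pose d k := if k is k'.+1 then 2 * c k'.+1 else c 0 - a.
have dS j : \sum_(k < j.+1) d k = two_sided_sum c j - a.
  by rewrite big_ord_recl/= /two_sided_sum mulr_sumr; ring.
have dV n : \sum_(j < n) \sum_(k < j.+1) d k = partial_variance c n - a * n%:R.
  under eq_bigr do rewrite dS.
  by rewrite sumrB sumr_const card_ord mulr_natr.
pose D : R := `|a| + 2 * B.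
have B0 : 0 <= B by rewrite (le_trans _ (cB 0)).
have D0 : 0 <= D by rewrite addr_ge0// mulr_ge0.
have dD k : `|d k| <= D.
  case: k => [|k] /=; last first.
    rewrite normrM ger0_norm// /D; have := cB k.+1; have := normr_ge0 a; lra.
  by rewrite (le_trans (ler_normB _ _))// /D; have := cB 0; lra.
have sD n : `|\sum_(k < n) d k| <= D * n.+1%:R.
  rewrite (le_trans (ler_norm_sum _ _ _))// (@le_trans _ _ (\sum_(k < n) D))//.
    exact: ler_sum.
  by rewrite sumr_const card_ord -[leLHS]mulr_natr ler_wpM2l// ler_nat.
have vD n : `|\sum_(j < n) \sum_(k < j.+1) d k| <= D * n.+1%:R ^+ 2.
  rewrite (le_trans (ler_norm_sum _ _ _))//.
  rewrite (@le_trans _ _ (\sum_(k < n) D * n.+1%:R))//.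
    apply: ler_sum => i _; rewrite (le_trans (sD _))// ler_wpM2l// ler_nat ltnS.
    exact: ltn_ord.
  rewrite sumr_const card_ord -[leLHS]mulr_natr expr2 mulrA ler_wpM2l//.
    by rewrite mulr_ge0.
  by rewrite ler_nat.
have K0 : 0 <= K by have := Va 0; rewrite partial_variance0 mulr0; lra.
have low N : - ((1 - l) * K) <= \sum_(n < N) l ^+ n * d n
    - l ^+ N * \sum_(k < N) d k
    - (1 - l) * (l ^+ N * \sum_(j < N) \sum_(k < j.+1) d k).
  rewrite -(sum_by_parts d) -mulrBr.
  rewrite -(sum_by_parts (fun j => \sum_(k < j.+1) d k)) -mulrN.
  rewrite ler_wpM2l ?subr_ge0 ?(ltW l1)//.
  apply: (@le_trans _ _ ((1 - l) * \sum_(n < N) l ^+ n * - K)); last first.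
    rewrite ler_wpM2l ?subr_ge0 ?(ltW l1)//; apply: ler_sum => n _.
    rewrite ler_wpM2l ?exprn_ge0 ?(ltW l0)// dV.
    by have := Va n.+1; lra.
  rewrite -mulr_suml mulrA mulrN lerNl opprK -[leRHS]mul1r ler_wpM2r//.
  by rewrite -opprB mulNr -subrX1 opprB gerBl exprn_ge0// ltW.
have cv : (fun N => \sum_(n < N) l ^+ n * d n
    - l ^+ N * \sum_(k < N) d k
    - (1 - l) * (l ^+ N * \sum_(j < N) \sum_(k < j.+1) d k)) @ \oo -->
    (2 * abel_sum c l - c 0 - a) - 0 - (1 - l) * 0.
  have small (u : nat -> R) : (forall n, `|u n| <= D * n.+1%:R ^+ 2) ->
      (fun n => l ^+ n * u n) @ \oo --> 0.
    move=> uD; have DX : (fun n => D * (n.+1%:R ^+ 2 * l ^+ n)) @ \oo --> 0.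
      by rewrite -(mulr0 D); apply: cvgMr; exact: cvg_natX2.
    apply: (squeeze_cvgr _ _ DX); last by rewrite -oppr0; exact: (cvgN DX).
    apply: nearW => n /=; rewrite -ler_norml normrM normrX (gtr0_norm l0).
    by rewrite mulrC mulrA ler_wpM2r// exprn_ge0// ltW.
  apply: cvgB; last by apply: cvgMr; exact: small.
  apply: cvgB; last first.
    apply: small => n; rewrite (le_trans (sD n))// ler_wpM2l//.
    by rewrite -natrX ler_nat expnS expn1 leq_pmulr.
  rewrite -cvg_shiftS.
  have -> : (fun n => \sum_(k < n.+1) l ^+ k * d k) =
    (fun n => 2 * series (fun k => l ^+ k * c k) n.+1 - c 0 - a).
    apply/funext => n; rewrite /series/= big_mkord !big_ord_recl/= !expr0.
    under eq_bigr do rewrite mulrCA.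
    by rewrite -mulr_sumr; ring.
  apply: cvgB; last exact: cvg_cst.
  apply: cvgB; last exact: cvg_cst.
  apply: cvgMr; rewrite (cvg_shiftS (series _)); exact: cvg_abel_sum cB _.
have : - ((1 - l) * K) <= 2 * abel_sum c l - c 0 - a - 0 - (1 - l) * 0.
  by rewrite -(cvg_lim _ cv)//; apply: limr_ge; [exact: cvgP cv|exact: nearW].
lra.
Qed.

Lemma abel_sum_le c B l a K : (forall k, `|c k| <= B) -> 0 < l < 1 ->
  (forall n, partial_variance c n <= a * n%:R + K) ->
  2 * abel_sum c l - c 0 <= a + (1 - l) * K.
Proof.
move=> cB l01 Va.
have sN j : two_sided_sum (fun k => - c k) j = - two_sided_sum c j.
  by rewrite /two_sided_sum sumrN; ring.
have VN n : partial_variance (fun k => - c k) n = - partial_variance c n.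
  by rewrite /partial_variance -sumrN; apply: eq_bigr => j _.
have NB k : `|- c k| <= B by rewrite normrN.
have aN : abel_sum (fun k => - c k) l = - abel_sum c l.
  apply/cvg_lim => //.
  have -> : series (fun k => l ^+ k * - c k) =
      (fun n => - series (fun k => l ^+ k * c k) n).
    apply/funext => n; rewrite /series/= -sumrN.
    by under eq_bigr do rewrite mulrN.
  apply: cvgN; exact: cvg_abel_sum cB _.
have := @abel_sum_ge _ B l (- a) K NB l01.
rewrite aN => H.
have /H : forall n, - a * n%:R - K <= partial_variance (fun k => - c k) n.
  by move=> n; rewrite VN; have := Va n; lra.
lra.
Qed.

End autocovariances.

(** * Integration formulas for kernels *)

Local Open Scope ereal_scope.

(** A functional on nonnegative measurable functions that is additive,
    homogeneous and continuous along nondecreasing sequences is determined by its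
    values on indicators, hence is the integral of the measure it induces.  This
    gives at once the integration formulas for densities, for the two-step law
    [mjoint] and for Metropolis-Hastings kernels. *)
Section integral_functional.
Context d (T : measurableType d) (R : realType).
Variables (nu : {measure set T -> \bar R}) (L : (T -> \bar R) -> \bar R).
Hypothesis L1 : forall A, measurable A -> L (fun x => (\1_A x)%:E) = nu A.
Hypothesis LD : forall f g, measurable_fun setT f -> measurable_fun setT g ->
  (forall x, 0 <= f x) -> (forall x, 0 <= g x) ->
  L (fun x => f x + g x) = L f + L g.
Hypothesis LZ : forall (k : R) f, (0 <= k)%R -> measurable_fun setT f ->
  (forall x, 0 <= f x) -> L (fun x => k%:E * f x) = k%:E * L f.
Hypothesis Llim : forall F : (T -> \bar R)^nat,
  (forall n, measurable_fun setT (F n)) -> (forall n x, 0 <= F n x) ->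
  (forall x, nondecreasing_seq (F ^~ x)) ->
  L (fun x => limn (F ^~ x)) = limn (fun n => L (F n)).

Import HBNNSimple.

Let L_sum (s : seq R) (A : R -> set T) : (forall r, r \in s -> 0 <= r)%R ->
  (forall r, measurable (A r)) ->
  L (fun x => (\sum_(r <- s) r * \1_(A r) x)%R%:E) =
  \sum_(r <- s) r%:E * nu (A r).
Proof.
move=> s0 mA; elim: s s0 => [|r s IH] s0.
  rewrite big_nil -[RHS](mul0e (nu set0)) -L1// -LZ//; last first.
    by apply/measurable_EFinP; exact: measurable_indic.
  by congr L; apply/funext => x; rewrite big_nil mul0e.
have r0 : (0 <= r)%R by apply: s0; rewrite mem_head.
have s0' r' : r' \in s -> (0 <= r')%R.
  by move=> r's; apply: s0; rewrite in_cons r's orbT.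
rewrite big_cons -IH// -L1// -LZ//; last first.
  by apply/measurable_EFinP; exact: measurable_indic.
rewrite -LD//.
- by congr L; apply/funext => x; rewrite big_cons EFinD EFinM.
- by apply: measurable_funeM; apply/measurable_EFinP; exact: measurable_indic.
- apply/measurable_EFinP; apply: measurable_sum => i.
  by apply: measurable_funM => //; exact: measurable_indic.
- by move=> x; rewrite mule_ge0// lee_fin.
- move=> x; rewrite lee_fin big_seq sumr_ge0// => i /s0' i0.
  by rewrite mulr_ge0.
Qed.

Let L_nnsfun (f : {nnsfun T >-> R}) : \int[nu]_x (f x)%:E = L (fun x => (f x)%:E).
Proof.
pose s : seq R := finmap.enum_fset (fset_set (range f)).
have fE x : f x = (\sum_(r <- s) r * \1_(f @^-1` [set r]) x)%R.
  by rewrite fimfunE fsbig_finite.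
have s0 r : r \in s -> (0 <= r)%R.
  by rewrite in_fset_set// inE => -[x _ <-].
rewrite integralT_nnsfun sintegralE fsbig_finite//.
rewrite (_ : (fun x => (f x)%:E) =
  (fun x => (\sum_(r <- s) r * \1_(f @^-1` [set r]) x)%R%:E)); last first.
  by apply/funext => x; rewrite {1}fE.
by rewrite L_sum.
Qed.

Lemma integral_functional (f : T -> \bar R) : measurable_fun setT f ->
  (forall x, 0 <= f x) -> \int[nu]_x f x = L f.
Proof.
move=> mf f0; pose f_ := nnsfun_approx measurableT mf.
have fE : f = (fun x => limn (fun n => (f_ n x)%:E)).
  apply/funext => x; apply/esym/cvg_lim => //.
  by apply: cvg_nnsfun_approx.
rewrite fE monotone_convergence//.
- rewrite Llim//.
  + by congr (limn _); apply/funext => n; exact: L_nnsfun.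
  + by move=> n; exact/measurable_EFinP.
  + by move=> n x; rewrite lee_fin.
  + by move=> x a b ab; rewrite lee_fin; exact/lefP/nd_nnsfun_approx.
- by move=> n; exact/measurable_EFinP.
- by move=> n x _; rewrite lee_fin.
- by move=> x _ a b ab; rewrite lee_fin; exact/lefP/nd_nnsfun_approx.
Qed.

End integral_functional.

Lemma integral_density d (T : measurableType d) (R : realType)
    (nu m : {measure set T -> \bar R}) (w : T -> R) :
  measurable_fun setT w -> (forall x, 0 <= w x)%R ->
  (forall A, measurable A -> nu A = \int[m]_(x in A) (w x)%:E) ->
  forall f, measurable_fun setT f -> (forall x, 0 <= f x) ->
  \int[nu]_x f x = \int[m]_x ((w x)%:E * f x).
Proof.
move=> /measurable_EFinP mw w0 nuE.
have wE0 x : 0 <= (w x)%:E by rewrite lee_fin.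
apply: (@integral_functional _ _ _ nu (fun f => \int[m]_x ((w x)%:E * f x))).
- move=> A mA; rewrite nuE// [RHS]integral_mkcond; apply: eq_integral => x _.
  by rewrite patchE indicE; case: ifPn => _; rewrite ?mule1 ?mule0.
- move=> f g mf mg f0 g0; rewrite -ge0_integralD//.
  + by apply: eq_integral => x _; rewrite ge0_muleDr.
  + by move=> x _; rewrite mule_ge0.
  + exact: emeasurable_funM.
  + by move=> x _; rewrite mule_ge0.
  + exact: emeasurable_funM.
- move=> k f k0 mf f0; rewrite -ge0_integralZl_EFin//.
  + by apply: eq_integral => x _; rewrite muleCA.
  + by move=> x _; rewrite mule_ge0.
  + exact: emeasurable_funM.
- move=> F mF F0 ndF; rewrite -monotone_convergence//.
  + apply: eq_integral => x _; rewrite limeMl//.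
    by apply: ereal_nondecreasing_is_cvgn; exact: ndF.
  + by move=> n; exact: emeasurable_funM.
  + by move=> n x _; rewrite mule_ge0.
  + by move=> x _ a b ab; rewrite lee_wpmul2l//; exact: ndF.
Qed.

Section integral_joint.
Context d d' (X : measurableType d) (Y : measurableType d') (R : realType).

Lemma measurable_integral_kernel (k : R.-pker X ~> Y) (f : X * Y -> \bar R) :
  measurable_fun setT f -> (forall p, 0 <= f p) ->
  measurable_fun setT (fun x => \int[k x]_y f (x, y)).
Proof. by move=> mf f0; exact: measurable_fun_integral_finite_kernel. Qed.

Lemma integral_mjoint (m : {measure set X -> \bar R}) (k : R.-pker X ~> Y)
    (f : X * Y -> \bar R) :
  measurable_fun setT f -> (forall p, 0 <= f p) ->
  \int[mjoint m k]_p f p = \int[m]_x \int[k x]_y f (x, y).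
Proof.
have mx (g : X * Y -> \bar R) x : measurable_fun setT g ->
  measurable_fun setT (fun y => g (x, y)) by move=> mg; exact: measurableT_comp.
move: f; apply: (@integral_functional _ _ _ (mjoint m k)
   (fun f => \int[m]_x \int[k x]_y f (x, y))).
- move=> A mA; apply: eq_integral => x _; rewrite integral_indic//.
    by rewrite setIT xsectionE.
  by rewrite -[X in measurable X]xsectionE; exact: measurable_xsection.
- move=> f g mf mg f0 g0; rewrite -ge0_integralD//.
  + by apply: eq_integral => x _; rewrite ge0_integralD//; exact: mx.
  + by move=> x _; exact: integral_ge0.
  + exact: measurable_integral_kernel.
  + by move=> x _; exact: integral_ge0.
  + exact: measurable_integral_kernel.
- move=> c f c0 mf f0; rewrite -ge0_integralZl_EFin//.
  + by apply: eq_integral => x _; rewrite ge0_integralZl_EFin//; exact: mx.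
  + by move=> x _; exact: integral_ge0.
  + exact: measurable_integral_kernel.
- move=> F mF F0 ndF.
  rewrite -monotone_convergence//.
  + apply: eq_integral => x _; rewrite -monotone_convergence//.
    by move=> n; exact: mx.
  + by move=> n; exact: measurable_integral_kernel.
  + by move=> n x _; exact: integral_ge0.
  + move=> x _ a b ab; apply: ge0_le_integral => //; [exact: mx|exact: mx|].
    by move=> y _; exact: ndF.
Qed.

End integral_joint.

Lemma integral_weighted d (X : measurableType d) (R : realType)
    (W : weight_set R) (Q : R.-pker X ~> weight W)
    (Q1 : forall x, \int[Q x]_w (wval w)%:E = 1) x (f : weight W -> \bar R) :
  measurable_fun setT f -> (forall w, 0 <= f w) ->
  \int[weighted_kernel Q1 x]_w f w = \int[Q x]_w ((wval w)%:E * f w).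
Proof.
apply: integral_density => //.
  exact: measurable_wval.
by move=> w; exact: wval_ge0.
Qed.

Lemma integral_mh_kernel d (E : measurableType d) (R : realType)
    (k : R.-pker E ~> E) (a : E * E -> R) (ma : measurable_fun setT a)
    (a01 : forall p, (0 <= a p <= 1)%R) x (f : E -> \bar R) :
  measurable_fun setT f -> (forall y, 0 <= f y) ->
  \int[mh_kernel k ma a01 x]_y f y = \int[k x]_y ((a (x, y))%:E * f y) +
    (1 - \int[k x]_y (a (x, y))%:E) * f x.
Proof.
have a0 y : 0 <= (a (x, y))%:E by rewrite lee_fin; case/andP: (a01 (x, y)).
have max : measurable_fun setT (fun y => (a (x, y))%:E).
  by apply/measurable_EFinP; exact: measurableT_comp.
have ia1 : \int[k x]_y (a (x, y))%:E <= 1.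
  rewrite -(@prob_kernel _ _ _ _ _ k x) -[leRHS]mul1e -integral_cst//.
  apply: ge0_le_integral => //.
  by move=> y _; rewrite lee_fin; case/andP: (a01 (x, y)).
have iaf : \int[k x]_y (a (x, y))%:E \is a fin_num.
  by rewrite ge0_fin_numE ?integral_ge0// (le_lt_trans ia1)// ltry.
have r0 : 0 <= 1 - \int[k x]_y (a (x, y))%:E by rewrite sube_ge0 ?iaf ?orbT.
set rho := 1 - _ in r0 *.
have rhof : rho \is a fin_num by rewrite fin_numB iaf.
move: f; apply: (@integral_functional _ _ _ (mh_kernel k ma a01 x)
  (fun f => \int[k x]_y ((a (x, y))%:E * f y) + rho * f x)).
- move=> A mA; rewrite /mh_kernel/= /mh_set diracE [in RHS]integral_mkcond.
  congr (_ + _); apply: eq_integral => y _.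
  by rewrite patchE indicE; case: ifPn => _; rewrite ?mule1 ?mule0.
- move=> f g mf mg f0 g0.
  rewrite [in RHS]addeACA -ge0_muleDr// -ge0_integralD//.
  + by congr (_ + _); apply: eq_integral => y _; rewrite ge0_muleDr.
  + by move=> y _; rewrite mule_ge0.
  + exact: emeasurable_funM.
  + by move=> y _; rewrite mule_ge0.
  + exact: emeasurable_funM.
- move=> c f c0 mf f0.
  have i0 : 0 <= \int[k x]_y ((a (x, y))%:E * f y).
    by apply: integral_ge0 => y _; rewrite mule_ge0.
  rewrite [in RHS]ge0_muleDr//; last by rewrite mule_ge0.
  rewrite -ge0_integralZl_EFin//.
  + rewrite [in RHS]muleCA; congr (_ + _).
    by apply: eq_integral => y _; rewrite muleCA.
  + by move=> y _; rewrite mule_ge0.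
  + exact: emeasurable_funM.
- move=> F mF F0 ndF.
  have cvF y : cvgn (F ^~ y) by apply: ereal_nondecreasing_is_cvgn; exact: ndF.
  rewrite limeD//.
  + congr (_ + _); last by rewrite limeMl.
    rewrite -monotone_convergence//.
    * by apply: eq_integral => y _; rewrite limeMl.
    * by move=> n; exact: emeasurable_funM.
    * by move=> n y _; rewrite mule_ge0.
    * by move=> y _ i j ij; rewrite lee_wpmul2l//; exact: ndF.
  + apply: ereal_nondecreasing_is_cvgn => i j ij; apply: ge0_le_integral => //.
    * by move=> y _; rewrite mule_ge0.
    * exact: emeasurable_funM.
    * exact: emeasurable_funM.
    * by move=> y _; rewrite lee_wpmul2l//; exact: ndF.
  + by apply: is_cvgeMl.
  + apply: ge0_adde_def; rewrite inE.
    * apply: lime_ge; last first.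
        by apply: nearW => n; apply: integral_ge0 => y _; rewrite mule_ge0.
      apply: ereal_nondecreasing_is_cvgn => i j ij; apply: ge0_le_integral => //.
      - by move=> y _; rewrite mule_ge0.
      - exact: emeasurable_funM.
      - exact: emeasurable_funM.
      - by move=> y _; rewrite lee_wpmul2l//; exact: ndF.
    * apply: lime_ge; first exact: is_cvgeMl.
      by apply: nearW => n; rewrite mule_ge0.
Qed.

(** * Square-integrable functions *)

Local Close Scope ereal_scope.

Section square_integrable.
Context d (T : measurableType d) (R : realType) (m : probability T R).
Implicit Types f g h : T -> R.

Definition L2 f :=
  measurable_fun setT f /\ (\int[m]_x ((f x ^+ 2)%R)%:E < +oo)%E.

Definition ip f g : R := \int[m]_x (f x * g x).

Lemma L2_sqr_integrable f : L2 f -> m.-integrable setT (fun x => (f x ^+ 2)%:E).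
Proof.
move=> [mf f2]; apply/integrableP; split.
  by apply/measurable_EFinP; exact: measurable_funX.
by under eq_integral do rewrite gee0_abs ?lee_fin ?sqr_ge0//.
Qed.

Lemma L2_mul_integrable f g : L2 f -> L2 g ->
  m.-integrable setT (fun x => (f x * g x)%:E).
Proof.
move=> f2 g2; have [[mf _] [mg _]] := (f2, g2).
apply: (le_integrable _ _ _
    (integrableD _ (L2_sqr_integrable f2) (L2_sqr_integrable g2))) => //.
  by apply/measurable_EFinP; exact: measurable_funM.
move=> x _; rewrite -EFinD !abse_EFin lee_fin [leRHS]ger0_norm.
  rewrite ler_norml; apply/andP; split.
    have := sqr_ge0 (f x + g x); have := sqr_ge0 (f x).
    by have := sqr_ge0 (g x); nra.
  have := sqr_ge0 (f x - g x); have := sqr_ge0 (f x).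
  by have := sqr_ge0 (g x); nra.
by rewrite addr_ge0 ?sqr_ge0.
Qed.

Lemma L2_cst (c : R) : L2 (cst c).
Proof.
split; first exact: measurable_cst.
have -> : (\int[m]_x (cst c x ^+ 2)%:E = \int[m]_x cst (c ^+ 2)%:E x)%E by [].
by rewrite integral_cst// [X in (_ * X)%E]probability_setT mule1 ltry.
Qed.

Lemma L2_integrable f : L2 f -> m.-integrable setT (EFin \o f).
Proof.
move=> f2; have := L2_mul_integrable f2 (L2_cst 1).
by apply: eq_integrable => // x _; rewrite /= mulr1.
Qed.

Lemma L2Z (a : R) f : L2 f -> L2 (fun x => a * f x).
Proof.
move=> f2; have [mf _] := f2; split; first exact: measurable_funM.
have /integrableP[_] := integrableZl measurableT (a ^+ 2) (L2_sqr_integrable f2).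
by under eq_integral do rewrite -EFinM -exprMn abse_EFin ger0_norm ?sqr_ge0//.
Qed.

Lemma L2D f g : L2 f -> L2 g -> L2 (fun x => f x + g x).
Proof.
move=> f2 g2; have [[mf _] [mg _]] := (f2, g2); split; first exact: measurable_funD.
have i2 := integrableD measurableT (integrableD measurableT (L2_sqr_integrable f2)
  (L2_sqr_integrable g2)) (integrableZl measurableT 2 (L2_mul_integrable f2 g2)).
have /integrableP[_] := i2.
apply: le_lt_trans; rewrite le_eqVlt; apply/orP; left; apply/eqP.
apply: eq_integral => x _.
rewrite [RHS](_ : _ = `|(f x ^+ 2 + g x ^+ 2 + 2 * (f x * g x))%:E|%E)//.
have -> : f x ^+ 2 + g x ^+ 2 + 2 * (f x * g x) = (f x + g x) ^+ 2 by ring.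
by rewrite abse_EFin ger0_norm ?sqr_ge0.
Qed.

Lemma L2N f : L2 f -> L2 (fun x => - f x).
Proof.
by move=> /(L2Z (-1)); rewrite (_ : (fun x => -1 * f x) = (fun x => - f x))//;
  apply/funext => x; rewrite mulN1r.
Qed.

Lemma L2B f g : L2 f -> L2 g -> L2 (fun x => f x - g x).
Proof. by move=> f2 g2; exact: L2D f2 (L2N g2). Qed.

Lemma ipC f g : ip f g = ip g f.
Proof. by apply: eq_Rintegral => x _; rewrite mulrC. Qed.

Lemma ipDl f g h : L2 f -> L2 g -> L2 h ->
  ip (fun x => f x + g x) h = ip f h + ip g h.
Proof.
move=> f2 g2 h2; rewrite /ip -RintegralD//; try exact: L2_mul_integrable.
by apply: eq_Rintegral => x _; rewrite mulrDl.
Qed.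

Lemma ipZl (a : R) f h : L2 f -> L2 h -> ip (fun x => a * f x) h = a * ip f h.
Proof.
move=> f2 h2; rewrite /ip -RintegralZl//; last exact: L2_mul_integrable.
by apply: eq_Rintegral => x _; rewrite mulrA.
Qed.

Lemma ipBl f g h : L2 f -> L2 g -> L2 h ->
  ip (fun x => f x - g x) h = ip f h - ip g h.
Proof.
move=> f2 g2 h2; rewrite /ip -RintegralB//; try exact: L2_mul_integrable.
by apply: eq_Rintegral => x _; rewrite mulrBl.
Qed.

Lemma ip_ge0 f : 0 <= ip f f.
Proof. by apply: Rintegral_ge0 => x _; rewrite -expr2 sqr_ge0. Qed.

Lemma ip_sqrD f g : L2 f -> L2 g ->
  ip (fun x => f x + g x) (fun x => f x + g x) = ip f f + 2 * ip f g + ip g g.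
Proof.
move=> f2 g2; have fg2 := L2D f2 g2.
by rewrite ipDl// (ipC f) (ipC g (fun x => _)) !ipDl// (ipC g f); ring.
Qed.

Lemma ip_sqrB f g : L2 f -> L2 g ->
  ip (fun x => f x - g x) (fun x => f x - g x) = ip f f - 2 * ip f g + ip g g.
Proof.
move=> f2 g2; have fg2 := L2B f2 g2.
by rewrite ipBl// (ipC f) (ipC g (fun x => _)) !ipBl// (ipC g f); ring.
Qed.

Lemma normr_ip_le f g : L2 f -> L2 g -> 2 * `|ip f g| <= ip f f + ip g g.
Proof.
move=> f2 g2; have := ip_ge0 (fun x => f x + g x).
have := ip_ge0 (fun x => f x - g x); rewrite ip_sqrB// ip_sqrD// => H1 H2.
by case: (ger0P (ip f g)); lra.
Qed.

Lemma ip_sqrE f : L2 f -> (ip f f)%:E = (\int[m]_x (f x ^+ 2)%:E)%E.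
Proof.
move=> f2; rewrite /ip /Rintegral fineK.
  by apply: eq_integral => x _; rewrite expr2.
by apply: integrable_fin_num => //; exact: L2_mul_integrable.
Qed.

(** Dominated convergence: [H] dominates the product because
    [2 * `|u * v| <= u ^+ 2 + v ^+ 2]. *)
Lemma cvg_ip (u v : nat -> T -> R) (u' v' : T -> R) (H : T -> \bar R) :
  (forall n, measurable_fun setT (u n)) -> (forall n, measurable_fun setT (v n)) ->
  measurable_fun setT u' -> measurable_fun setT v' ->
  m.-integrable setT H ->
  (forall n x, (u n x ^+ 2)%:E <= H x)%E -> (forall n x, (v n x ^+ 2)%:E <= H x)%E ->
  {ae m, forall x, u n x @[n --> \oo] --> u' x} ->
  {ae m, forall x, v n x @[n --> \oo] --> v' x} ->
  ip (u n) (v n) @[n --> \oo] --> ip u' v'.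
Proof.
move=> mu mv mu' mv' iH uH vH uu' vv'.
have mE (a b : T -> R) : measurable_fun setT a -> measurable_fun setT b ->
    measurable_fun setT (fun x => (a x * b x)%:E).
  by move=> ma mb; apply/measurable_EFinP; exact: measurable_funM.
have [] := @dominated_convergence _ _ _ m setT measurableT
  (fun n x => (u n x * v n x)%:E) (fun x => (u' x * v' x)%:E) H.
- by move=> n; exact: mE.
- exact: mE.
- apply: filterS2 uu' vv' => x ux vx _.
  by apply: cvg_EFin; [exact: nearW|exact: cvgM].
- exact: iH.
- apply/aeW => x n _; rewrite abse_EFin.
  have : (((u n x ^+ 2 + v n x ^+ 2) / 2)%:E <= H x)%E.
    move: (uH n x) (vH n x); case: (H x) => [h| |]//; rewrite ?leey//.
    by rewrite !lee_fin; lra.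
  apply: le_trans; rewrite lee_fin.
  have := sqr_ge0 (u n x + v n x); have := sqr_ge0 (u n x - v n x).
  by rewrite ler_norml; nra.
move=> iuv _ cv; rewrite /ip /Rintegral.
apply: fine_cvg; rewrite fineK//.
by apply: integrable_fin_num.
Qed.

End square_integrable.

(** * Disintegration of two-step laws *)

(** The image of [m] under [h] is [m'].  Stating this for integrals of nonnegative
    functions fits the projections and the exchange of coordinates of a two-step
    law, where it comes from stationarity and reversibility. *)
Section change_of_variables.
Context d d' (T : measurableType d) (T' : measurableType d') (R : realType).
Variables (m : probability T R) (m' : probability T' R) (h : T -> T').
Hypothesis mh : measurable_fun setT h.
Hypothesis mE : forall F : T' -> \bar R, measurable_fun setT F ->
  (forall x, 0 <= F x)%E -> (\int[m]_x F (h x) = \int[m']_x F x)%E.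

Lemma integral_comp (F : T' -> \bar R) : measurable_fun setT F ->
  (\int[m]_x F (h x) = \int[m']_x F x)%E.
Proof.
move=> mF; rewrite integralE [RHS]integralE.
rewrite -(mE (measurable_funepos mF)) ?funepos_ge0//.
rewrite -(mE (measurable_funeneg mF)) ?funeneg_ge0//.
by congr (_ - _)%E; apply: eq_integral => x _; rewrite ?funeposE ?funenegE.
Qed.

Lemma integrable_comp (F : T' -> \bar R) : m'.-integrable setT F ->
  m.-integrable setT (fun x => F (h x)).
Proof.
move=> /integrableP[mF iF]; apply/integrableP; split.
  exact: measurableT_comp.
by rewrite (mE (F := fun x => `|F x|%E))//; exact: measurableT_comp.
Qed.

Lemma Rintegral_comp (f : T' -> R) : measurable_fun setT f ->
  \int[m]_x f (h x) = \int[m']_x f x.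
Proof.
move=> mf; rewrite /Rintegral (integral_comp (F := EFin \o f))//.
exact/measurable_EFinP.
Qed.

Lemma L2_comp (f : T' -> R) : L2 m' f -> L2 m (fun x => f (h x)).
Proof.
move=> [mf f2]; split; first exact: measurableT_comp.
rewrite (mE (F := fun x => (f x ^+ 2)%:E))//.
- by apply/measurable_EFinP; exact: measurable_funX.
- by move=> x; rewrite lee_fin sqr_ge0.
Qed.

Lemma ip_comp (f g : T' -> R) : measurable_fun setT f -> measurable_fun setT g ->
  ip m (fun x => f (h x)) (fun x => g (h x)) = ip m' f g.
Proof.
move=> mf mg; rewrite /ip (Rintegral_comp (f := fun x => f x * g x))//.
exact: measurable_funM.
Qed.

Lemma ae_comp (P : T' -> Prop) :
  {ae m', forall x, P x} -> {ae m, forall x, P (h x)}.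
Proof.
move=> [N [mN N0 PN]]; exists (h @^-1` N); split.
- by rewrite -[X in measurable X]setTI; exact: mh.
- have mi : measurable_fun setT (fun x => (\1_N x)%:E : \bar R).
    by apply/measurable_EFinP; exact: measurable_indic.
  have := mE mi.
  have -> : (\int[m']_x (\1_N x)%:E = 0)%E by rewrite integral_indic// setIT.
  move=> <-//; rewrite -(setIT (h @^-1` N)) -integral_indic//.
  by rewrite -[X in measurable X]setTI; exact: mh.
- by move=> x Px; apply: PN.
Qed.

End change_of_variables.

Section kernel_section.
Context d d' (X : measurableType d) (Y : measurableType d') (R : realType).
Variable k : R.-pker X ~> Y.

(** The measure [k x], with its structure of probability. *)
Definition kernel_at (x : X) : set Y -> \bar R := k x.

HB.instance Definition _ x := Measure.on (kernel_at x).

HB.instance Definition _ x :=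
  Measure_isProbability.Build _ _ _ (kernel_at x) (prob_kernel x).

End kernel_section.

Section disintegration.
Context d d' (X : measurableType d) (Y : measurableType d') (R : realType).
Variables (m : probability X R) (k : R.-pker X ~> Y).
Local Notation M := (pjoint m k).

Lemma integral_pjoint (F : X * Y -> \bar R) : measurable_fun setT F ->
  (forall p, 0 <= F p)%E ->
  (\int[M]_p F p = \int[m]_x \int[k x]_y F (x, y))%E.
Proof. exact: integral_mjoint. Qed.

Lemma integral_pjoint_fst (F : X -> \bar R) : measurable_fun setT F ->
  (forall x, 0 <= F x)%E -> (\int[M]_p F p.1 = \int[m]_x F x)%E.
Proof.
move=> mF F0; rewrite (integral_pjoint (F := fun p => F p.1))//.
  by apply: eq_integral => x _ /=; rewrite integral_cst// prob_kernel mule1.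
exact: measurableT_comp.
Qed.

Lemma ae_integrable_kernel (F : X * Y -> \bar R) : M.-integrable setT F ->
  {ae m, forall x, (k x).-integrable setT (fun y => F (x, y))}.
Proof.
move=> /integrableP[mF]; rewrite integral_pjoint//; last first.
  exact: measurableT_comp.
move=> iF.
have iG : m.-integrable setT (fun x => \int[k x]_y `|F (x, y)|)%E.
  apply/integrableP; split.
    apply: (@measurable_integral_kernel _ _ _ _ _ k (fun p => `|F p|%E)) => //.
    exact: measurableT_comp.
  by under eq_integral do rewrite gee0_abs ?integral_ge0//.
have := integrable_ae measurableT iG.
apply: filterS => x /(_ I) xF; apply/integrableP; split.
  exact: measurableT_comp.
by rewrite ltey_eq xF.
Qed.

Lemma integral_section (F : X * Y -> \bar R) x :
  (\int[k x]_y F (x, y) =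
   \int[k x]_y F^\+ (x, y) - \int[k x]_y F^\- (x, y))%E.
Proof.
rewrite integralE; congr (_ - _)%E; apply: eq_integral => y _.
  by rewrite !funeposE.
by rewrite !funenegE.
Qed.

Lemma measurable_integral_section (F : X * Y -> \bar R) :
  measurable_fun setT F -> measurable_fun setT (fun x => \int[k x]_y F (x, y))%E.
Proof.
move=> mF; under eq_fun do rewrite integral_section.
apply: emeasurable_funB; apply: measurable_integral_kernel => //.
  exact: measurable_funepos.
exact: measurable_funeneg.
Qed.

Lemma measurable_Rintegral_kernel (f : X * Y -> R) : measurable_fun setT f ->
  measurable_fun setT (fun x => \int[k x]_y f (x, y)).
Proof.
move=> mf; rewrite /Rintegral; apply: measurableT_comp => //.
by apply: (@measurable_integral_section (EFin \o f)); exact/measurable_EFinP.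
Qed.

(** Fubini's theorem for [m(dx) k(x, dy)].  On the null set of those [x] where the
    inner integral is infinite, its real-valued version is 0. *)
Lemma Rintegral_pjoint (f : X * Y -> R) : M.-integrable setT (EFin \o f) ->
  \int[M]_p f p = \int[m]_x \int[k x]_y f (x, y).
Proof.
move=> fi; have /integrableP[mf _] := fi.
have mpos := measurable_funepos mf; have mneg := measurable_funeneg mf.
have ipos := integral_funepos_lt_pinfty measurableT fi.
have ineg := integral_funeneg_lt_pinfty measurableT fi.
rewrite integral_pjoint// in ipos; rewrite integral_pjoint// in ineg.
have iA : m.-integrable setT (fun x => \int[k x]_y (EFin \o f)^\+ (x, y))%E.
  apply/integrableP; split; first exact: measurable_integral_kernel.
  by under eq_integral do rewrite gee0_abs ?integral_ge0//.
have iB : m.-integrable setT (fun x => \int[k x]_y (EFin \o f)^\- (x, y))%E.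
  apply/integrableP; split; first exact: measurable_integral_kernel.
  by under eq_integral do rewrite gee0_abs ?integral_ge0//.
have -> : \int[M]_p f p = fine (\int[m]_x (\int[k x]_y (f (x, y))%:E))%E.
  rewrite /Rintegral integralE !integral_pjoint// -integralB//.
  congr fine; apply: eq_integral => x _.
  by rewrite [RHS](integral_section (EFin \o f)).
rewrite /Rintegral; congr fine; apply: ae_eq_integral => //.
- exact: (@measurable_integral_section (EFin \o f)).
- apply/measurable_EFinP; apply: measurable_Rintegral_kernel.
  exact/measurable_EFinP.
- have := ae_integrable_kernel fi; apply: filterS => x xi _.
  by rewrite fineK// integrable_fin_num.
Qed.

End disintegration.

Lemma measurable_integral_kernel_comp d d' d'' (T : measurableType d)
    (X : measurableType d') (Y : measurableType d'') (R : realType)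
    (k : R.-pker X ~> Y) (h : T -> X) (f : T * Y -> \bar R) :
  measurable_fun setT h -> measurable_fun setT f -> (forall p, 0 <= f p)%E ->
  measurable_fun setT (fun t => \int[k (h t)]_y f (t, y))%E.
Proof.
move=> mh mf f0; pose k' : R.-fker (T * X)%type ~> Y := kernel.kernel_snd k.
have mk : measurable_fun setT (fun p => \int[k' p]_y f (p.1, y))%E.
  apply: (measurable_fun_integral_finite_kernel
    (fun r : (T * X) * Y => f (r.1.1, r.2)) k') => //.
  apply: measurableT_comp => //; apply: measurable_fun_pair => //.
  exact: measurableT_comp.
rewrite (_ : (fun t => _) =
  (fun p => \int[k' p]_y f (p.1, y))%E \o (fun t => (t, h t)))//.
by apply: measurableT_comp => //; exact: measurable_fun_pair.
Qed.

(** * Reversible kernels and their quadratic forms *)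

Section reversible_kernel.
Context d (E : measurableType d) (R : realType).
Variables (nu : probability E R) (K : R.-pker E ~> E).

Definition reversible := forall F : E * E -> \bar R, measurable_fun setT F ->
  (forall p, 0 <= F p)%E ->
  (\int[nu]_x \int[K x]_y F (x, y) = \int[nu]_x \int[K x]_y F (y, x))%E.

Local Notation M := (pjoint nu K).

(** [<K g, h>], the expectation of [g (X_1) * h (X_0)].  Written on the two-step
    law, it is bilinear and symmetric without the exceptional null sets on which
    [kernel_op K g] is not the integral of [g]. *)
Definition step_form (g h : E -> R) : R :=
  ip M (fun p => g p.2) (fun p => h p.1).

Definition dirichlet (g : E -> R) : \bar R :=
  (\int[nu]_x \int[K x]_y ((g x - g y) ^+ 2)%:E)%E.

(** The quadratic form of [I - l K]. *)
Definition resolvent_form (l : R) (g h : E -> R) : R :=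
  ip nu g h - l * step_form g h.

Hypothesis rev : reversible.

Let msnd : measurable_fun [set: E * E] snd. Proof. exact: measurable_snd. Qed.
Let mfst : measurable_fun [set: E * E] fst. Proof. exact: measurable_fst. Qed.

Let mswap : measurable_fun [set: E * E] (fun p => (p.2, p.1)).
Proof. exact: measurable_fun_pair. Qed.

Lemma integral_pjoint_swap (F : E * E -> \bar R) : measurable_fun setT F ->
  (forall p, 0 <= F p)%E -> (\int[M]_p F (p.2, p.1) = \int[M]_p F p)%E.
Proof.
move=> mF F0; rewrite [RHS]integral_pjoint// rev//.
rewrite (integral_pjoint nu K (F := fun p => F (p.2, p.1)))//.
exact: measurableT_comp.
Qed.

Lemma integral_pjoint_snd (F : E -> \bar R) : measurable_fun setT F ->
  (forall x, 0 <= F x)%E -> (\int[M]_p F p.2 = \int[nu]_x F x)%E.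
Proof.
move=> mF F0; rewrite -(integral_pjoint_fst nu K mF F0).
rewrite -(integral_pjoint_swap (F := fun p => F p.1))//.
exact: measurableT_comp.
Qed.

Lemma L2_fst (f : E -> R) : L2 nu f -> L2 M (fun p => f p.1).
Proof.
move=> f2; apply: (L2_comp (m' := nu) (h := fst)) => //.
exact: integral_pjoint_fst.
Qed.

Lemma L2_snd (f : E -> R) : L2 nu f -> L2 M (fun p => f p.2).
Proof.
move=> f2; apply: (L2_comp (m' := nu) (h := snd)) => //.
exact: integral_pjoint_snd.
Qed.

Lemma ip_fst (f g : E -> R) : L2 nu f -> L2 nu g ->
  ip M (fun p => f p.1) (fun p => g p.1) = ip nu f g.
Proof.
move=> [mf _] [mg _]; apply: (ip_comp (m' := nu) (h := fst)) => //.
exact: integral_pjoint_fst.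
Qed.

Lemma ip_snd (f g : E -> R) : L2 nu f -> L2 nu g ->
  ip M (fun p => f p.2) (fun p => g p.2) = ip nu f g.
Proof.
move=> [mf _] [mg _]; apply: (ip_comp (m' := nu) (h := snd)) => //.
exact: integral_pjoint_snd.
Qed.

Lemma step_formC (g h : E -> R) : L2 nu g -> L2 nu h ->
  step_form g h = step_form h g.
Proof.
move=> g2 h2; have [[mg _] [mh _]] := (g2, h2).
rewrite /step_form [RHS]ipC.
have mg1 : measurable_fun setT (fun p : E * E => g p.1) by exact: measurableT_comp.
have mh2 : measurable_fun setT (fun p : E * E => h p.2) by exact: measurableT_comp.
exact: (ip_comp integral_pjoint_swap mg1 mh2).
Qed.

Lemma step_formDl (f g h : E -> R) : L2 nu f -> L2 nu g -> L2 nu h ->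
  step_form (fun x => f x + g x) h = step_form f h + step_form g h.
Proof.
by move=> f2 g2 h2; rewrite /step_form ipDl//;
  [exact: L2_snd|exact: L2_snd|exact: L2_fst].
Qed.

Lemma step_formBl (f g h : E -> R) : L2 nu f -> L2 nu g -> L2 nu h ->
  step_form (fun x => f x - g x) h = step_form f h - step_form g h.
Proof.
by move=> f2 g2 h2; rewrite /step_form ipBl//;
  [exact: L2_snd|exact: L2_snd|exact: L2_fst].
Qed.

Lemma step_formZl (a : R) (f h : E -> R) : L2 nu f -> L2 nu h ->
  step_form (fun x => a * f x) h = a * step_form f h.
Proof.
by move=> f2 h2; rewrite /step_form ipZl//; [exact: L2_snd|exact: L2_fst].
Qed.

Lemma normr_step_form_le (g h : E -> R) : L2 nu g -> L2 nu h ->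
  2 * `|step_form g h| <= ip nu g g + ip nu h h.
Proof.
move=> g2 h2; rewrite -(ip_snd g2 g2) -(ip_fst h2 h2).
by apply: normr_ip_le; [exact: L2_snd|exact: L2_fst].
Qed.

Lemma dirichletE (g : E -> R) : L2 nu g ->
  dirichlet g = (2 * (ip nu g g - step_form g g))%:E.
Proof.
move=> g2; have [mg _] := g2.
rewrite /dirichlet -(integral_pjoint nu K (F := fun p => ((g p.1 - g p.2) ^+ 2)%:E)).
- rewrite -ip_sqrE; last by apply: L2B; [exact: L2_fst|exact: L2_snd].
  rewrite ip_sqrB; [|exact: L2_fst|exact: L2_snd].
  by rewrite ip_fst// ip_snd// ipC; congr EFin; rewrite /step_form; ring.
- apply/measurable_EFinP; apply: measurable_funX.
  by apply: measurable_funB; exact: measurableT_comp.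
- by move=> p; rewrite lee_fin sqr_ge0.
Qed.

Lemma resolvent_form_ge0 (l : R) (g : E -> R) : 0 < l < 1 -> L2 nu g ->
  0 <= resolvent_form l g g.
Proof.
move=> /andP[l0 l1] g2; rewrite /resolvent_form.
have := normr_step_form_le g2 g2; have := ip_ge0 nu g.
have := ler_norm (step_form g g); nra.
Qed.

Lemma resolvent_form_sqrB (l : R) (g h : E -> R) : L2 nu g -> L2 nu h ->
  resolvent_form l (fun x => g x - h x) (fun x => g x - h x) =
  resolvent_form l g g - 2 * resolvent_form l h g + resolvent_form l h h.
Proof.
move=> g2 h2; have gh2 := L2B g2 h2; rewrite /resolvent_form ip_sqrB//.
rewrite step_formBl// (step_formC g2 gh2) (step_formC h2 gh2) !step_formBl//.
by rewrite (step_formC g2 h2) (ipC _ g h); ring.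
Qed.

(** Jensen's inequality: the variance of [f] under [K x] is nonnegative.  It holds
    at every [x], since the right-hand side is infinite when [f] is not
    square-integrable for [K x]. *)
Lemma kernel_op_sqr_le (f : E -> R) x : measurable_fun setT f ->
  ((kernel_op K f x ^+ 2)%:E <= \int[K x]_y (f y ^+ 2)%:E)%E.
Proof.
move=> mf; have [f2|] := ltP (\int[K x]_y (f y ^+ 2)%:E)%E +oo%E; last first.
  by rewrite leye_eq => /eqP ->; rewrite leey.
have {}f2 : L2 (kernel_at K x) f by [].
pose c := kernel_op K f x; rewrite -/c.
have -> : (\int[K x]_y (f y ^+ 2)%:E)%E = (ip (kernel_at K x) f f)%:E.
  by rewrite ip_sqrE.
have c2 := L2_cst (kernel_at K x) c.
have := ip_ge0 (kernel_at K x) (fun y => f y - cst c y).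
rewrite ip_sqrB// lee_fin.
have -> : ip (kernel_at K x) f (cst c) = c * c.
  by rewrite /ip RintegralZr//; exact: L2_integrable.
have -> : ip (kernel_at K x) (cst c) (cst c) = c * c.
  rewrite -[LHS]/(\int[kernel_at K x]_(y in setT) (c * c)) Rintegral_cst//.
  by rewrite [X in fine X](@prob_kernel _ _ _ _ _ K x) mulr1.
by rewrite expr2; lra.
Qed.

Lemma measurable_kernel_op (f : E -> R) : measurable_fun setT f ->
  measurable_fun setT (kernel_op K f).
Proof.
move=> mf; apply: (measurable_Rintegral_kernel K (f := fun p => f p.2)).
exact: measurableT_comp.
Qed.

Lemma L2_kernel_op (f : E -> R) : L2 nu f -> L2 nu (kernel_op K f).
Proof.
move=> [mf f2]; split; first exact: measurable_kernel_op.
have mf2 : measurable_fun setT (fun y => (f y ^+ 2)%:E).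
  by apply/measurable_EFinP; exact: measurable_funX.
rewrite -integral_pjoint_snd// in f2; last by move=> x; rewrite lee_fin sqr_ge0.
rewrite (integral_pjoint nu K (F := fun p => (f p.2 ^+ 2)%:E)) in f2; last 2 first.
- exact: (measurableT_comp mf2 msnd).
- by move=> x; rewrite lee_fin sqr_ge0.
apply: le_lt_trans f2; apply: ge0_le_integral => //.
- by move=> x _; rewrite lee_fin sqr_ge0.
- apply/measurable_EFinP; apply: measurable_funX; exact: measurable_kernel_op.
- apply: (measurable_integral_kernel K (f := fun p => (f p.2 ^+ 2)%:E)).
    exact: (measurableT_comp mf2 msnd).
  by move=> x; rewrite lee_fin sqr_ge0.
- by move=> x _; exact: kernel_op_sqr_le.
Qed.

Lemma ae_integrable_kernel_op (f : E -> R) : nu.-integrable setT (EFin \o f) ->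
  {ae nu, forall x, (K x).-integrable setT (EFin \o f)}.
Proof.
move=> fi.
apply: (ae_integrable_kernel (F := fun p => (f p.2)%:E)).
exact: (integrable_comp msnd integral_pjoint_snd fi).
Qed.

Lemma Rintegral_kernel_op (f : E -> R) : nu.-integrable setT (EFin \o f) ->
  \int[nu]_x kernel_op K f x = \int[nu]_x f x.
Proof.
move=> fi; have /integrableP[/measurable_EFinP mf _] := fi.
rewrite -(Rintegral_comp integral_pjoint_snd mf).
rewrite (Rintegral_pjoint (f := fun p => f p.2))//.
exact: (integrable_comp msnd integral_pjoint_snd fi).
Qed.

Lemma step_form_kernel_op (g h : E -> R) : L2 nu g -> L2 nu h ->
  step_form g h = ip nu (kernel_op K g) h.
Proof.
move=> g2 h2; have [[mg _] [mh _]] := (g2, h2).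
have gh : (pjoint nu K).-integrable setT (EFin \o (fun p => g p.2 * h p.1)).
  exact: L2_mul_integrable (L2_snd g2) (L2_fst h2).
rewrite /step_form /ip (Rintegral_pjoint gh) /Rintegral; congr fine.
apply: ae_eq_integral => //.
- apply/measurable_EFinP; apply: (measurable_Rintegral_kernel K
   (f := fun p => g p.2 * h p.1)).
  by apply: measurable_funM; exact: measurableT_comp.
- apply/measurable_EFinP; apply: measurable_funM => //.
  exact: measurable_kernel_op.
- have := ae_integrable_kernel_op (L2_integrable g2).
  apply: filterS => x gx _; congr EFin.
  by rewrite -[fine _]/(\int[K x]_y (g y * h x)) RintegralZr.
Qed.

End reversible_kernel.

(** * Variational principle for the resolvent *)

Section resolvent_variational.
Context d (E : measurableType d) (R : realType).
Variables (nu : probability E R) (K : R.-pker E ~> E).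
Hypothesis rev : reversible nu K.
(** [e] stands for the centred iterates [K^k f - nu(f)].  Only the weak form of
    [e k.+1 = K (e k)] is assumed, because that identity may fail on a null set
    with the convention that [kernel_op] is 0 where the integral is infinite. *)
Variable e : nat -> E -> R.
Hypothesis e2 : forall k, L2 nu (e k).
Hypothesis eS : forall k h, L2 nu h ->
  step_form nu K (e k) h = ip nu (e k.+1) h.

Definition autocov k : R := ip nu (e 0) (e k).

Lemma ip_orbit j k : ip nu (e j) (e k) = autocov (j + k).
Proof.
elim: j k => [//|j IH] k.
by rewrite -eS// step_formC// eS// ipC IH addSnnS.
Qed.

(** [K] is a contraction: [|e k.+1|^2 = <K (e k), e k.+1>] is at most the mean of
    [|e k|^2] and [|e k.+1|^2]. *)
Lemma orbit_norm_le k : ip nu (e k) (e k) <= autocov 0.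
Proof.
elim: k => [//|k]; apply: le_trans.
have := normr_step_form_le rev (e2 k) (e2 k.+1).
rewrite eS//; have := ler_norm (ip nu (e k.+1) (e k.+1)); lra.
Qed.

Lemma normr_autocov_le k : `|autocov k| <= autocov 0.
Proof.
have := normr_ip_le (e2 0) (e2 k); have := orbit_norm_le k.
by rewrite /autocov; lra.
Qed.

(** This is [|e k + e k.+1|^2]. *)
Lemma autocov_pair_ge0 k :
  0 <= autocov k.*2 + 2 * autocov k.*2.+1 + autocov k.*2.+2.
Proof.
have := ip_ge0 nu (fun x => e k x + e k.+1 x); rewrite ip_sqrD// !ip_orbit.
by rewrite !addSn !addnS addnn.
Qed.

Definition partial_resolvent (l : R) (n : nat) (x : E) : R :=
  series (fun k => l ^+ k * e k x) n.

Lemma partial_resolvent0 l : partial_resolvent l 0 = cst 0.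
Proof. by apply/funext => x; rewrite /partial_resolvent/series/= big_nil. Qed.

Lemma partial_resolventS l n : partial_resolvent l n.+1 =
  (fun x => partial_resolvent l n x + l ^+ n * e n x).
Proof.
by apply/funext => x; rewrite /partial_resolvent/series/= big_nat_recr.
Qed.

Lemma L2_partial_resolvent l n : L2 nu (partial_resolvent l n).
Proof.
elim: n => [|n IH]; first by rewrite partial_resolvent0; exact: L2_cst.
by rewrite partial_resolventS; apply: L2D => //; exact: L2Z.
Qed.

Lemma ip_partial_resolvent l n h : L2 nu h ->
  ip nu (partial_resolvent l n) h = series (fun k => l ^+ k * ip nu (e k) h) n.
Proof.
move=> h2; elim: n => [|n IH].
  rewrite partial_resolvent0 /series/= big_nil /ip.
  by under eq_Rintegral do rewrite mul0r; rewrite Rintegral_cst// mul0r.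
rewrite partial_resolventS seriesSr -IH ipDl//.
- by rewrite ipZl.
- exact: L2_partial_resolvent.
- exact: L2Z.
Qed.

Lemma step_form_partial_resolvent l n h : L2 nu h ->
  l * step_form nu K (partial_resolvent l n) h =
  ip nu (partial_resolvent l n) h + l ^+ n * ip nu (e n) h - ip nu (e 0) h.
Proof.
move=> h2; elim: n => [|n IH].
  rewrite expr0 mul1r addrK partial_resolvent0 /step_form /ip.
  under [in LHS]eq_Rintegral do rewrite mul0r.
  under [in RHS]eq_Rintegral do rewrite mul0r.
  by rewrite !Rintegral_cst// !mul0r mulr0.
have p2 := L2_partial_resolvent l n.
have z2 := L2Z (l ^+ n) (e2 n).
rewrite partial_resolventS step_formDl// step_formZl// eS// mulrDr IH.
by rewrite ipDl// ipZl// exprS; ring.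
Qed.

Lemma resolvent_form_partial l n h : L2 nu h ->
  resolvent_form nu K l (partial_resolvent l n) h =
  ip nu (e 0) h - l ^+ n * ip nu (e n) h.
Proof.
by move=> h2; rewrite /resolvent_form step_form_partial_resolvent//; ring.
Qed.

Lemma cvg_remainder (l B : R) (u : nat -> R) : 0 < l < 1 ->
  (forall n, `|u n| <= B) -> (fun n => l ^+ n * u n) @ \oo --> 0.
Proof.
move=> /andP[l0 l1] uB.
have lB : geometric B l @ \oo --> 0 by apply: cvg_geometric; rewrite gtr0_norm.
apply: (squeeze_cvgr _ _ lB); last by rewrite -oppr0; exact: (cvgN lB).
apply: nearW => n /=; rewrite -ler_norml normrM normrX (gtr0_norm l0) mulrC.
by rewrite ler_wpM2r// exprn_ge0// ltW.
Qed.

Lemma normr_ip_orbit_le n g : L2 nu g ->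
  `|ip nu (e n) g| <= autocov 0 + ip nu g g.
Proof.
move=> g2; have := normr_ip_le (e2 n) g2; have := orbit_norm_le n.
have := normr_ge0 (ip nu (e n) g); have := ip_ge0 nu g; lra.
Qed.

Lemma normr_ip_orbit_partial_le l n : 0 < l < 1 ->
  `|ip nu (e n) (partial_resolvent l n)| <= autocov 0 * (1 - l)^-1.
Proof.
move=> /andP[l0 l1]; rewrite ipC ip_partial_resolvent// /series/=.
rewrite (le_trans (ler_norm_sum _ _ _))//.
have l1' : `|l| < 1 by rewrite gtr0_norm.
have c0 : 0 <= autocov 0 := ip_ge0 _ _.
apply: le_trans (geometric_le_lim n c0 l0 l1').
rewrite /series/=; apply: ler_sum => k _.
rewrite normrM normrX (gtr0_norm l0) mulrC ler_wpM2r ?exprn_ge0 ?(ltW l0)//.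
by rewrite ip_orbit normr_autocov_le.
Qed.

Lemma cvg_ip_partial_resolvent l : 0 < l < 1 ->
  (fun n => ip nu (e 0) (partial_resolvent l n)) @ \oo --> abel_sum autocov l.
Proof.
move=> l01.
have -> : (fun n => ip nu (e 0) (partial_resolvent l n)) =
    series (fun k => l ^+ k * autocov k).
  apply/funext => n; rewrite ipC ip_partial_resolvent//.
  by congr series; apply/funext => k; rewrite ip_orbit addn0.
exact: cvg_abel_sum normr_autocov_le l01.
Qed.

(** The variational principle
    [<f, (I - l K)^-1 f> = sup_g (2 <f, g> - <g, (I - l K) g>)], in the direction
    that bounds the left-hand side from below by any trial function: expand the
    nonnegative form of [I - l K] at [g - p_n], where [p_n] is the [n]-th partial sum
    of the resolvent series, and let [n] tend to infinity. *)
Lemma abel_sum_ge_variational l g : 0 < l < 1 -> L2 nu g ->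
  2 * ip nu (e 0) g - resolvent_form nu K l g g <= abel_sum autocov l.
Proof.
move=> l01 g2; pose p := partial_resolvent l.
have p2 n : L2 nu (p n) := L2_partial_resolvent l n.
have cv : (fun n => ip nu (e 0) (p n) + 2 * (l ^+ n * ip nu (e n) g)
    - l ^+ n * ip nu (e n) (p n)) @ \oo --> abel_sum autocov l + 2 * 0 - 0.
  apply: cvgB; last first.
    by apply: cvg_remainder => // n; exact: normr_ip_orbit_partial_le.
  apply: cvgD; first exact: cvg_ip_partial_resolvent.
  by apply: cvgMr; apply: cvg_remainder => // n; exact: normr_ip_orbit_le.
rewrite mulr0 addr0 subr0 in cv; rewrite -(cvg_lim _ cv)//.
apply: limr_ge; first exact: cvgP cv.
apply: nearW => n; have := resolvent_form_ge0 rev l01 (L2B g2 (p2 n)).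
by rewrite resolvent_form_sqrB// !resolvent_form_partial//; lra.
Qed.

Section resolvent.
Variable l : R.
Hypothesis l01 : 0 < l < 1.
Let l0 : 0 < l. Proof. by case/andP: l01. Qed.
Let l1 : l < 1. Proof. by case/andP: l01. Qed.

(** Dominates the squares of all partial resolvents, by the Cauchy-Schwarz
    inequality for the weights [l ^+ k]; it is integrable because the [e k] are
    bounded in L2. *)
Definition dominating (x : E) : \bar R :=
  ((1 - l)^-1%:E * \sum_(0 <= k <oo) (l ^+ k * e k x ^+ 2)%:E)%E.

Let term_ge0 x k : (0 <= (l ^+ k * e k x ^+ 2)%:E)%E.
Proof. by rewrite lee_fin mulr_ge0 ?sqr_ge0// exprn_ge0// ltW. Qed.

Let mterm k : measurable_fun setT (fun x => (l ^+ k * e k x ^+ 2)%:E).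
Proof.
apply/measurable_EFinP; apply: measurable_funM => //.
by apply: measurable_funX; case: (e2 k).
Qed.

Let inv_ge0 : 0 <= (1 - l)^-1.
Proof. by rewrite invr_ge0 subr_ge0 ltW. Qed.

Lemma cauchy_weighted (a : nat -> R) n :
  (series (fun k => l ^+ k * `|a k|) n) ^+ 2 <=
  (1 - l)^-1 * series (fun k => l ^+ k * a k ^+ 2) n.
Proof.
set S := series _ n; set Q := series (fun k => l ^+ k * a k ^+ 2) n.
pose G := series (geometric 1 l) n.
have G1 : G <= (1 - l)^-1.
  by rewrite -[leRHS]mul1r; apply: geometric_le_lim => //; rewrite gtr0_norm.
have H t : 0 <= G * t ^+ 2 - 2 * t * S + Q.
  have -> : G * t ^+ 2 - 2 * t * S + Q =
      series (fun k => l ^+ k * (t - `|a k|) ^+ 2) n.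
    rewrite /G /S /Q !seriesEord /= mulr_suml mulr_sumr -sumrB -big_split/=.
    apply: eq_bigr => k _; rewrite sqrrB real_normK ?num_real//; ring.
  rewrite seriesEord/=; apply: sumr_ge0 => k _.
  by rewrite mulr_ge0 ?sqr_ge0// exprn_ge0// ltW.
have il : (1 - l)^-1 * (1 - l) = 1 by rewrite mulVf// subr_eq0 gt_eqF.
(* the quadratic polynomial of H at t = S * (1 - l) *)
have HS : S ^+ 2 * (1 - l) <= Q.
  have : G * (S * (1 - l)) ^+ 2 <= (1 - l)^-1 * (S * (1 - l)) ^+ 2.
    by rewrite ler_wpM2r// sqr_ge0.
  have -> : (1 - l)^-1 * (S * (1 - l)) ^+ 2 = S ^+ 2 * (1 - l).
    rewrite exprMn expr2 [(1 - l) ^+ 2]expr2 mulrCA !mulrA.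
    by rewrite -(mulrA _ (1 - l)^-1) il mulr1.
  by have := H (S * (1 - l)); nra.
have -> : S ^+ 2 = (1 - l)^-1 * (S ^+ 2 * (1 - l)).
  by rewrite mulrCA il mulr1.
by rewrite ler_wpM2l.
Qed.

Lemma series_le_dominating x n :
  ((series (fun k => l ^+ k * `|e k x|) n ^+ 2)%:E <= dominating x)%E.
Proof.
apply: (@le_trans _ _ ((1 - l)^-1 * series (fun k => l ^+ k * e k x ^+ 2) n)%:E).
  by rewrite lee_fin; exact: cauchy_weighted.
rewrite EFinM /dominating lee_wpmul2l ?lee_fin//.
by rewrite seriesEnat/= -sumEFin; exact: nneseries_lim_ge.
Qed.

Lemma partial_resolvent_sqr_le n x :
  ((partial_resolvent l n x ^+ 2)%:E <= dominating x)%E.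
Proof.
apply: le_trans (series_le_dominating x n); rewrite lee_fin.
rewrite -[leLHS]real_normK ?num_real// lerXn2r ?nnegrE//.
  by rewrite seriesEord; apply: sumr_ge0 => k _; rewrite mulr_ge0// exprn_ge0// ltW.
rewrite /partial_resolvent !seriesEord/= (le_trans (ler_norm_sum _ _ _))//.
by apply: ler_sum => k _; rewrite normrM normrX (gtr0_norm l0).
Qed.

Lemma dominating_ge0 x : (0 <= dominating x)%E.
Proof. by rewrite /dominating mule_ge0 ?lee_fin// nneseries_ge0. Qed.

Lemma measurable_dominating : measurable_fun setT dominating.
Proof.
by apply: measurable_funeM; apply: ge0_emeasurable_sum.
Qed.

Lemma integrable_dominating : nu.-integrable setT dominating.
Proof.
apply/integrableP; split; first exact: measurable_dominating.
under eq_integral do rewrite gee0_abs ?dominating_ge0//.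
rewrite /dominating ge0_integralZl_EFin//; last 2 first.
- by move=> x _; exact: nneseries_ge0.
- by apply: ge0_emeasurable_sum.
rewrite lte_mul_pinfty ?lee_fin// integral_nneseries//.
have -> : (\sum_(0 <= k <oo) \int[nu]_x (l ^+ k * e k x ^+ 2)%:E =
           \sum_(0 <= k <oo) (l ^+ k * ip nu (e k) (e k))%:E)%E.
  apply: eq_eseriesr => k _; rewrite EFinM ip_sqrE//.
  under eq_integral do rewrite EFinM.
  rewrite ge0_integralZl_EFin ?exprn_ge0 ?(ltW l0)//.
  - by move=> x _; rewrite lee_fin sqr_ge0.
  - by apply/measurable_EFinP; apply: measurable_funX; case: (e2 k).
apply: (@le_lt_trans _ _ (autocov 0 * (1 - l)^-1)%:E); last exact: ltry.
apply: lime_le.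
  apply: is_cvg_nneseries => k _ _.
  by rewrite lee_fin mulr_ge0 ?ip_ge0// exprn_ge0// ltW.
apply: nearW => n; rewrite sumEFin lee_fin.
have l1' : `|l| < 1 by rewrite gtr0_norm.
apply: le_trans (geometric_le_lim n (ip_ge0 _ _) l0 l1').
rewrite /series/=; apply: ler_sum => k _.
by rewrite mulrC ler_wpM2r ?exprn_ge0 ?(ltW l0)// orbit_norm_le.
Qed.

Definition resolvent (x : E) : R := limn (partial_resolvent l ^~ x).

Lemma measurable_partial_resolvent n : measurable_fun setT (partial_resolvent l n).
Proof. by case: (L2_partial_resolvent l n). Qed.

Lemma measurable_resolvent : measurable_fun setT resolvent.
Proof. apply: measurable_limn; exact: measurable_partial_resolvent. Qed.

Lemma ae_cvg_partial_resolvent :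
  {ae nu, forall x, partial_resolvent l n x @[n --> \oo] --> resolvent x}.
Proof.
have := integrable_ae measurableT integrable_dominating.
apply: filterS => x /(_ I) fx; apply: normed_cvg.
have -> : [normed series (fun k => l ^+ k * e k x)] =
    series (fun k => l ^+ k * `|e k x|).
  by congr series; apply/funext => k; rewrite /= normrM normrX (gtr0_norm l0).
apply: nondecreasing_is_cvgn.
  apply/nondecreasing_seqP => n; rewrite seriesSr lerDl mulr_ge0//.
  by rewrite exprn_ge0// ltW.
exists (fine (dominating x) + 1) => _ [n _ <-].
have := series_le_dominating x n; rewrite -{1}(fineK fx) lee_fin.
set S := series _ n; set H := fine _ => SH.
have := sqr_ge0 (S - 1); nra.
Qed.

Lemma ae_resolvent_sqr_le :
  {ae nu, forall x, ((resolvent x ^+ 2)%:E <= dominating x)%E}.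
Proof.
apply: filterS ae_cvg_partial_resolvent => x cx.
have cx2 : (partial_resolvent l n x ^+ 2)%:E @[n --> \oo] --> (resolvent x ^+ 2)%:E.
  by apply: cvg_EFin; [exact: nearW|exact: cvgM].
rewrite -(cvg_lim _ cx2)//; apply: lime_le; first exact: cvgP cx2.
by apply: nearW => n; exact: partial_resolvent_sqr_le.
Qed.

Lemma L2_resolvent : L2 nu resolvent.
Proof.
split; first exact: measurable_resolvent.
have /integrableP[_] := integrable_dominating; apply: le_lt_trans.
apply: ae_ge0_le_integral => //.
- by move=> x _; rewrite lee_fin sqr_ge0.
- apply/measurable_EFinP; apply: measurable_funX; exact: measurable_resolvent.
- by apply: measurableT_comp => //; exact: measurable_dominating.
- apply: filterS ae_resolvent_sqr_le => x H _.
  by rewrite gee0_abs// dominating_ge0.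
Qed.

(** The resolvent attains the supremum in the variational principle.  For the
    partial sums, the right-hand side differs from the partial Abel sum by a
    geometrically small remainder; then pass to the limit by dominated
    convergence. *)
Lemma abel_sum_le_resolvent :
  abel_sum autocov l <= 2 * ip nu (e 0) resolvent -
                        resolvent_form nu K l resolvent resolvent.
Proof.
pose p := partial_resolvent l.
have p2 n : L2 nu (p n) := L2_partial_resolvent l n.
have cip : ip nu (e 0) (p n) @[n --> \oo] --> ip nu (e 0) resolvent.
  apply: (@cvg_ip _ _ _ _ _ _ _ _ (fun x => dominating x + (e 0 x ^+ 2)%:E)%E).
  - by move=> n; case: (e2 0).
  - by move=> n; exact: measurable_partial_resolvent.
  - by case: (e2 0).
  - exact: measurable_resolvent.
  - apply: integrableD => //; first exact: integrable_dominating.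
    exact: L2_sqr_integrable.
  - by move=> n x; rewrite leeDr// dominating_ge0.
  - move=> n x; apply: le_trans (partial_resolvent_sqr_le n x) _.
    by rewrite leeDl// lee_fin sqr_ge0.
  - by apply: aeW => x; exact: cvg_cst.
  - exact: ae_cvg_partial_resolvent.
have cpp : ip nu (p n) (p n) @[n --> \oo] --> ip nu resolvent resolvent.
  apply: (@cvg_ip _ _ _ _ _ _ _ _ dominating).
  - by move=> n; exact: measurable_partial_resolvent.
  - by move=> n; exact: measurable_partial_resolvent.
  - exact: measurable_resolvent.
  - exact: measurable_resolvent.
  - exact: integrable_dominating.
  - exact: partial_resolvent_sqr_le.
  - exact: partial_resolvent_sqr_le.
  - exact: ae_cvg_partial_resolvent.
  - exact: ae_cvg_partial_resolvent.
have mdom := measurable_dominating.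
have idom1 := integrable_comp (@measurable_fst _ _ E E)
  (integral_pjoint_fst nu K) integrable_dominating.
have idom2 := integrable_comp (@measurable_snd _ _ E E)
  (integral_pjoint_snd rev) integrable_dominating.
have csp : step_form nu K (p n) (p n) @[n --> \oo] -->
    step_form nu K resolvent resolvent.
  apply: (@cvg_ip _ _ _ _ _ _ _ _ (fun x => dominating x.1 + dominating x.2)%E).
  - by move=> n; apply: measurableT_comp => //; exact: measurable_partial_resolvent.
  - by move=> n; apply: measurableT_comp => //; exact: measurable_partial_resolvent.
  - by apply: measurableT_comp => //; exact: measurable_resolvent.
  - by apply: measurableT_comp => //; exact: measurable_resolvent.
  - exact: integrableD.
  - move=> n x; apply: le_trans (partial_resolvent_sqr_le n x.2) _.
    by rewrite leeDr// dominating_ge0.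
  - move=> n x; apply: le_trans (partial_resolvent_sqr_le n x.1) _.
    by rewrite leeDl// dominating_ge0.
  - exact: (ae_comp (@measurable_snd _ _ E E) (integral_pjoint_snd rev)
      ae_cvg_partial_resolvent).
  - exact: (ae_comp (@measurable_fst _ _ E E) (integral_pjoint_fst nu K)
      ae_cvg_partial_resolvent).
have cv1 : (2 * ip nu (e 0) (p n) - resolvent_form nu K l (p n) (p n))
    @[n --> \oo] -->
    2 * ip nu (e 0) resolvent - resolvent_form nu K l resolvent resolvent.
  apply: cvgB; first exact: cvgMr.
  by apply: cvgB => //; exact: cvgMr.
have cv2 : (2 * ip nu (e 0) (p n) - resolvent_form nu K l (p n) (p n))
    @[n --> \oo] --> abel_sum autocov l.
  have -> : (fun n =>
      2 * ip nu (e 0) (p n) - resolvent_form nu K l (p n) (p n)) =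
      (fun n => ip nu (e 0) (p n) + l ^+ n * ip nu (e n) (p n)).
    by apply/funext => n; rewrite resolvent_form_partial//; ring.
  rewrite -[X in _ --> X]addr0; apply: cvgD; first exact: cvg_ip_partial_resolvent.
  by apply: cvg_remainder => // n; exact: normr_ip_orbit_partial_le.
by rewrite (cvg_unique _ cv2 cv1).
Qed.

End resolvent.
End resolvent_variational.

(** * Variance of sums along the stationary chain *)

Lemma path_expectation_ge0 d (E : measurableType d) (R : realType)
    (K : R.-pker E ~> E) n (F : seq E -> \bar R) x :
  (forall s, 0 <= F s)%E -> (0 <= path_expectation K n F x)%E.
Proof.
elim: n F x => [|n IH] F x F0 /=; first exact: F0.
by apply: integral_ge0 => y _; apply: IH => s; exact: F0.
Qed.

Section stationary_variance.
Context d (E : measurableType d) (R : realType).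
Variables (nu : probability E R) (K : R.-pker E ~> E).
Hypothesis rev : reversible nu K.
Variables (f : E -> R) (m : R).
Hypothesis f2 : L2 nu f.

(** [K^k f - m], with the iterates taken before centring, as in the resolvent. *)
Definition orbit (k : nat) (x : E) : R := iter k (kernel_op K) f x - m.

Lemma L2_iter_kernel_op k : L2 nu (iter k (kernel_op K) f).
Proof. by elim: k => [//|k IH]; exact: L2_kernel_op. Qed.

Lemma L2_orbit k : L2 nu (orbit k).
Proof. by apply: L2B; [exact: L2_iter_kernel_op|exact: L2_cst]. Qed.

Lemma step_form_orbit k h : L2 nu h ->
  step_form nu K (orbit k) h = ip nu (orbit k.+1) h.
Proof.
move=> h2; have m2 := L2_cst nu m; have i2 := L2_iter_kernel_op k.
rewrite /orbit (step_formBl rev (g := cst m))// step_form_kernel_op//.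
rewrite (ipBl (g := cst m))//; last exact: L2_kernel_op.
by congr (_ - _); exact: (ip_fst K m2 h2).
Qed.

Let f0 : E -> R := orbit 0.
Let f02 : L2 nu f0 := L2_orbit 0.

Lemma integrable_kernel_op (g : E -> R) : nu.-integrable setT (EFin \o g) ->
  nu.-integrable setT (EFin \o kernel_op K g).
Proof.
move=> gi; have /integrableP[mg ig] := gi.
have mgR : measurable_fun setT g by exact/measurable_EFinP.
have mn : measurable_fun setT (fun x => `|(g x)%:E|%E) by exact: measurableT_comp.
apply/integrableP; split.
  by apply/measurable_EFinP; exact: measurable_kernel_op.
apply: le_lt_trans ig; rewrite -[leRHS](integral_pjoint_snd rev)//.
have mn2 : measurable_fun setT (fun p : E * E => `|(g p.2)%:E|%E).
  exact: (measurableT_comp mn).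
rewrite (integral_pjoint nu K (F := fun p => `|(g p.2)%:E|%E))//.
apply: ge0_le_integral => //.
- apply: measurableT_comp => //; apply/measurable_EFinP.
  exact: measurable_kernel_op.
- exact: (measurable_integral_kernel K mn2).
- move=> x _; rewrite /= /kernel_op /Rintegral.
  apply: le_trans (le_abse_integral (K x) measurableT mg).
  rewrite -[X in (_ <= `|X|)%E]/(\int[K x]_y (g y)%:E)%E.
  by case: (\int[K x]_y _)%E => [r| |] //=; rewrite leey.
Qed.

Lemma ae_ae_kernel (P : E -> Prop) : {ae nu, forall x, P x} ->
  {ae nu, forall x, {ae K x, forall y, P y}}.
Proof.
move=> [N [mN N0 PN]].
have mi : measurable_fun setT (fun x => (\1_N x)%:E : \bar R).
  by apply/measurable_EFinP; exact: measurable_indic.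
have mi2 : measurable_fun setT (fun p : E * E => (\1_N p.2)%:E : \bar R).
  exact: (measurableT_comp mi).
have KN : (\int[nu]_x `|K x N| = 0)%E.
  under eq_integral do rewrite gee0_abs//.
  have -> : (\int[nu]_x K x N = \int[nu]_x \int[K x]_y (\1_N y)%:E)%E.
    by apply: eq_integral => x _; rewrite integral_indic// setIT.
  rewrite -(integral_pjoint nu K (F := fun p => (\1_N p.2)%:E))//.
  rewrite (integral_pjoint_snd rev (F := fun x => (\1_N x)%:E))//.
  by rewrite integral_indic// setIT.
have mK : measurable_fun setT (fun x => K x N) by exact: measurable_kernel.
have := (ae_eq_integral_abs nu measurableT mK).1 KN.
apply: filterS => x /(_ I) KxN; exists N; split => //.
Qed.

(** The conditional mean and mean square, given the starting point, of the sum of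
    [n] steps of the chain; they are the coefficients of the polynomial in [a] of
    [ae_shifted_square]. *)
Fixpoint path_mean (n : nat) : E -> R :=
  if n is n'.+1 then kernel_op K (fun y => f0 y + path_mean n' y) else cst 0.

Fixpoint path_square (n : nat) : E -> R :=
  if n is n'.+1 then kernel_op K (fun y =>
    f0 y * f0 y + 2 * (f0 y * path_mean n' y) + path_square n' y) else cst 0.

Lemma L2_path_mean n : L2 nu (path_mean n).
Proof.
by elim: n => [|n IH]; [exact: L2_cst|apply: L2_kernel_op => //; exact: L2D].
Qed.

Lemma path_square_integrand n : nu.-integrable setT (EFin \o path_square n) ->
  nu.-integrable setT (fun y =>
    (f0 y * f0 y + 2 * (f0 y * path_mean n y) + path_square n y)%:E).
Proof.
move=> IH; have := integrableD measurableT (integrableD measurableT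
   (L2_mul_integrable f02 f02) (integrableZl measurableT 2
   (L2_mul_integrable f02 (L2_path_mean n)))) IH.
by apply: eq_integrable.
Qed.

Lemma integrable_path_square n : nu.-integrable setT (EFin \o path_square n).
Proof.
elim: n => [|n IH]; first exact: L2_integrable (L2_cst nu 0).
by apply: integrable_kernel_op; exact: path_square_integrand.
Qed.

(** Peeling off the first step of a path adds its value to the sum, whence the free
    shift [a] in the induction. *)
Definition shifted_square (n : nat) (a : R) (x : E) : \bar R :=
  path_expectation K n (fun s => ((a + \sum_(y <- s) (f y - m)) ^+ 2)%:E) x.

Lemma shifted_squareS n a x : shifted_square n.+1 a x =
  (\int[K x]_y shifted_square n (a + f0 y) y)%E.
Proof.
rewrite /shifted_square /=; apply: eq_integral => y _; congr path_expectation.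
by apply/funext => s; rewrite big_cons addrA.
Qed.

Lemma shifted_square_ge0 n a x : (0 <= shifted_square n a x)%E.
Proof.
by apply: path_expectation_ge0 => s; rewrite lee_fin sqr_ge0.
Qed.

Lemma measurable_shifted_square n :
  measurable_fun setT (fun p : R * E => shifted_square n p.1 p.2).
Proof.
elim: n => [|n IH].
  rewrite (_ : (fun p => _) = (fun p : R * E => (p.1 ^+ 2)%:E)); last first.
    by apply/funext => p; rewrite /shifted_square /= big_nil addr0.
  by apply/measurable_EFinP; exact: measurable_funX.
pose F (q : (R * E) * E) := shifted_square n (q.1.1 + f0 q.2) q.2.
rewrite (_ : (fun p => _) =
    (fun p : R * E => \int[K p.2]_y F (p, y))%E); last first.
  by apply/funext => p; rewrite shifted_squareS.
have [mf0 _] := f02.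
apply: (measurable_integral_kernel_comp K (h := snd)); first exact: measurable_snd.
  apply: (measurableT_comp IH (g := fun q : (R * E) * E => (q.1.1 + f0 q.2, q.2))).
  apply: measurable_fun_pair => //; apply: measurable_funD.
    exact: measurableT_comp.
  exact: measurableT_comp.
by move=> q; exact: shifted_square_ge0.
Qed.

(** One null set serves for all [a], because in the induction step [a] is replaced
    by a function of the integration variable. *)
Lemma ae_shifted_square n : {ae nu, forall x, forall a,
  shifted_square n a x = (a ^+ 2 + 2 * a * path_mean n x + path_square n x)%:E}.
Proof.
elim: n => [|n IH].
  apply: aeW => x a.
  by rewrite /shifted_square /= big_nil addr0 mulr0 !addr0.
have u2 : L2 nu (fun y => f0 y + path_mean n y).
  by apply: L2D => //; exact: L2_path_mean.
have vi := path_square_integrand (integrable_path_square n).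
apply: filterS3 (ae_ae_kernel IH)
  (ae_integrable_kernel_op rev (L2_integrable u2))
  (ae_integrable_kernel_op rev vi) => x IHx ux vx a.
rewrite shifted_squareS.
have ci : (K x).-integrable setT (EFin \o cst (a ^+ 2)).
  exact: (L2_integrable (L2_cst (kernel_at K x) (a ^+ 2))).
have ui : (K x).-integrable setT
    (fun y => (2 * a * (f0 y + path_mean n y))%:E).
  by have := integrableZl measurableT (2 * a) ux; apply: eq_integrable.
have cui : (K x).-integrable setT
    (fun y => (cst (a ^+ 2) y + 2 * a * (f0 y + path_mean n y))%:E).
  by have := integrableD measurableT ci ui; apply: eq_integrable.
have ti : (K x).-integrable setT (fun y =>
   (cst (a ^+ 2) y + 2 * a * (f0 y + path_mean n y) +
   (f0 y * f0 y + 2 * (f0 y * path_mean n y) + path_square n y))%:E).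
  by have := integrableD measurableT cui vx; apply: eq_integrable.
have /integrableP[mt _] := ti.
have mG : measurable_fun setT (fun y => shifted_square n (a + f0 y) y).
  have [mf0 _] := f02.
  apply: (measurableT_comp (measurable_shifted_square n)
    (g := fun y => (a + f0 y, y))).
  by apply: measurable_fun_pair => //; exact: measurable_funD.
rewrite (ae_eq_integral _ _ _ _ mt)//; last first.
  apply: filterS IHx => y Hy _; rewrite Hy; congr EFin.
  by rewrite /=; ring.
rewrite -[LHS]fineK; last exact: integrable_fin_num.
congr EFin; rewrite -[LHS]/(\int[K x]_y
  (cst (a ^+ 2) y + 2 * a * (f0 y + path_mean n y) +
   (f0 y * f0 y + 2 * (f0 y * path_mean n y) + path_square n y))).
rewrite RintegralD//; congr (_ + _).
rewrite RintegralD// RintegralZl//; congr (_ + _).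
rewrite -[LHS]/(\int[K x]_(y in setT) (a ^+ 2)) Rintegral_cst//.
by rewrite [X in fine X](@prob_kernel _ _ _ _ _ K x) mulr1.
Qed.

Lemma ip_path_mean n h : L2 nu h ->
  ip nu (path_mean n) h = \sum_(k < n) ip nu (orbit k.+1) h.
Proof.
elim: n h => [|n IH] h h2.
  rewrite big_ord0 /ip; under eq_Rintegral do rewrite mul0r.
  by rewrite Rintegral_cst// mul0r.
have u2 := L2_path_mean n; have Kh2 := L2_kernel_op rev h2.
rewrite /= -step_form_kernel_op//; last exact: L2D.
rewrite step_formDl// (step_form_orbit 0 h2) (step_formC rev u2 h2).
rewrite step_form_kernel_op// (ipC _ _ (path_mean n)) IH// big_ord_recl/=.
congr (_ + _).
apply: eq_bigr => k _.
rewrite ipC -step_form_kernel_op//; last exact: L2_orbit.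
by rewrite step_formC//; [rewrite step_form_orbit|exact: L2_orbit].
Qed.

Lemma Rintegral_path_square n :
  \int[nu]_x path_square n x = partial_variance (autocov nu orbit) n.
Proof.
elim: n => [|n IH].
  by rewrite partial_variance0 Rintegral_cst// mul0r.
have u2 := L2_path_mean n.
have i1 := L2_mul_integrable f02 f02.
have i2 := L2_mul_integrable f02 u2.
have i2' : nu.-integrable setT (fun y => (2 * (f0 y * path_mean n y))%:E).
  by have := integrableZl measurableT 2 i2; apply: eq_integrable.
have i12 : nu.-integrable setT
    (fun y => (f0 y * f0 y + 2 * (f0 y * path_mean n y))%:E).
  by have := integrableD measurableT i1 i2'; apply: eq_integrable.
rewrite /= Rintegral_kernel_op//; last first.
  exact: path_square_integrand (integrable_path_square n).
rewrite RintegralD//; last exact: integrable_path_square.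
rewrite RintegralD// RintegralZl// IH partial_varianceS addrC; congr (_ + _).
rewrite /two_sided_sum; congr (_ + 2 * _).
rewrite -[LHS]/(ip nu f0 (path_mean n)) ipC ip_path_mean//.
by apply: eq_bigr => k _; rewrite ipC.
Qed.

Lemma integral_path_expectation n :
  (\int[nu]_x path_expectation K n
    (fun s => ((\sum_(y <- s) (f y - m)) ^+ 2)%:E) x =
  (partial_variance (autocov nu orbit) n)%:E)%E.
Proof.
rewrite -Rintegral_path_square /Rintegral fineK; last first.
  by apply: integrable_fin_num => //; exact: integrable_path_square.
have /integrableP[mv _] := integrable_path_square n.
have mG : measurable_fun setT (shifted_square n 0).
  rewrite (_ : shifted_square n 0 = (fun p : R * E => shifted_square n p.1 p.2)
    \o (fun y => (0, y)))//.
  apply: measurableT_comp; first exact: measurable_shifted_square.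
  exact: measurable_fun_pair.
transitivity (\int[nu]_x shifted_square n 0 x)%E.
  apply: eq_integral => x _; rewrite /shifted_square; congr path_expectation.
  by apply/funext => s; rewrite add0r.
apply: ae_eq_integral => //; apply: filterS (ae_shifted_square n) => x Hx _.
by rewrite Hx expr0n mulr0 mul0r !add0r.
Qed.

End stationary_variance.

(** * Tierney's ratio *)

Local Open Scope ereal_scope.

(** The common core of the reversibility of both kernels.  On the symmetric set of
    the definition of [r], the measure [mu(dy) q(y, dx)] has density [r] with
    respect to [mu(dx) q(x, dy)], so integrating [A (x, y) = r (x, y) * B (y, x)]
    against the latter is integrating [B (y, x)] against the former, which is an
    exchange of names.  Off that set both integrands vanish. *)
Lemma tierney_exchange d (X : measurableType d) (R : realType)
    (mu : probability X R) (q : R.-pker X ~> X) (r : X * X -> R)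
    (A B : X * X -> \bar R) :
  tierney_ratio mu q r ->
  measurable_fun setT A -> (forall p, 0 <= A p) ->
  measurable_fun setT B -> (forall p, 0 <= B p) ->
  (forall p, r p = 0%R -> A p = 0) -> (forall p, r p = 0%R -> B p = 0) ->
  (forall x y, (0 < r (x, y))%R -> (r (x, y) * r (y, x) = 1)%R ->
    A (x, y) = (r (x, y))%:E * B (y, x)) ->
  \int[mu]_x \int[q x]_y A (x, y) = \int[mu]_x \int[q x]_y B (x, y).
Proof.
move=> hr mA A0 mB B0 rA rB AB.
have r0 := tierney_ratio_ge0 hr; have mr := tierney_ratio_measurable hr.
have [_ [S [mS Ssym _ _ [rS rpos rinv rnS]]]] := hr.
rewrite -(integral_mjoint mu q mA A0) -(integral_mjoint mu q mB B0).
set m := mjoint mu q in rS *.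
pose swap (p : X * X) := (p.2, p.1).
have mswap : measurable_fun setT swap by exact: measurable_fun_pair.
(* the measure structure of an image takes the measurability proof as argument *)
pose image : {measure set (X * X) -> \bar R} := pushforward m swap.
pose bwd := image mswap.
(* bwd restricted to S has density r with respect to m *)
pose bwdS : {measure set (X * X) -> \bar R} := mrestr bwd mS.
have mBs : measurable_fun setT (B \o swap) by exact: measurableT_comp.
have B0s p : 0 <= B (swap p) by exact: B0.
have E1 : \int[bwdS]_p B (swap p) = \int[m]_p ((r p)%:E * B (swap p)).
  apply: (integral_density mr r0 _ mBs B0s).
  - move=> C mC; have -> : bwdS C = \int[m]_(p in C `&` S) (r p)%:E.
      by rewrite -rS; [|exact: measurableI|exact: subIsetr].
    rewrite integral_mkcondr; apply: eq_integral => p _.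
    rewrite patchE; case: ifPn => // /negP pS.
    by rewrite rnS// => Sp; apply: pS; rewrite inE.
have E2 : \int[bwdS]_p B (swap p) = \int[bwd]_p ((\1_S p)%:E * B (swap p)).
  apply: (integral_density (measurable_indic mS) _ _ mBs B0s).
    by [].
  move=> C mC; rewrite integral_indic//.
  by rewrite -[LHS]/(bwd (C `&` S)) setIC.
have swapK p : swap (swap p) = p by case: p.
have -> : \int[m]_p A p = \int[m]_p ((r p)%:E * B (swap p)).
  apply: eq_integral => -[x y] _; have [Sxy|nSxy] := pselect (S (x, y)).
    by apply: AB; [exact: rpos|exact: rinv].
  by rewrite (rA _ (rnS _ nSxy)) (rnS _ nSxy) mul0e.
have mG : measurable_fun setT (fun p => (\1_S p)%:E * B (swap p)).
  by apply: emeasurable_funM mBs; apply/measurable_EFinP; exact: measurable_indic.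
have G0 p : 0 <= (\1_S p)%:E * B (swap p) by rewrite mule_ge0// lee_fin.
rewrite -E1 E2 (ge0_integral_pushforward mswap m measurableT mG (fun p _ => G0 p)).
rewrite preimage_setT; apply: eq_integral => p _; rewrite /= swapK indicE.
have [_|pS] := boolP (swap p \in S); first by rewrite mul1e.
rewrite mul0e (rB p)//; apply: rnS => Sp; move/negP: pS; apply; apply/mem_set.
by case: p Sp => x y; exact: Ssym.
Qed.

(** * Metropolis-Hastings and pseudo-marginal kernels *)

Section metropolis_hastings.
Context d (E : measurableType d) (R : realType).
Variables (nu : probability E R) (k : R.-pker E ~> E) (a : E * E -> R).
Hypotheses (ma : measurable_fun setT a) (a01 : forall p, (0 <= a p <= 1)%R).

Let a0 p : 0 <= (a p)%:E. Proof. by rewrite lee_fin; case/andP: (a01 p). Qed.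

Let maE : measurable_fun setT (EFin \o a).
Proof. exact/measurable_EFinP. Qed.

Let rho_ge0 x : 0 <= 1 - \int[k x]_y (a (x, y))%:E.
Proof.
have ia1 : \int[k x]_y (a (x, y))%:E <= 1.
  rewrite -(@prob_kernel _ _ _ _ _ k x) -[leRHS]mul1e -integral_cst//.
  apply: ge0_le_integral => //.
    by apply/measurable_EFinP; exact: measurableT_comp.
  by move=> y _; rewrite lee_fin; case/andP: (a01 (x, y)).
by rewrite sube_ge0 ?orbT.
Qed.

Let measurable_rho : measurable_fun setT (fun x => 1 - \int[k x]_y (a (x, y))%:E).
Proof.
apply: emeasurable_funB => //.
exact: (measurable_integral_kernel k (f := EFin \o a)).
Qed.

(** Rejected proposals do not contribute. *)
Lemma dirichlet_mh_kernel (g : E -> R) : measurable_fun setT g ->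
  dirichlet nu (mh_kernel k ma a01) g =
  \int[nu]_x \int[k x]_y (a (x, y) * (g x - g y) ^+ 2)%:E.
Proof.
move=> mg; apply: eq_integral => x _; rewrite integral_mh_kernel.
- by rewrite subrr expr0n mule0 adde0; apply: eq_integral => y _; rewrite EFinM.
- by apply/measurable_EFinP; apply: measurable_funX; exact: measurable_funB.
- by move=> y; rewrite lee_fin sqr_ge0.
Qed.

Lemma reversible_mh_kernel :
  (forall F : E * E -> \bar R, measurable_fun setT F -> (forall p, 0 <= F p) ->
    \int[nu]_x \int[k x]_y ((a (x, y))%:E * F (x, y)) =
    \int[nu]_x \int[k x]_y ((a (x, y))%:E * F (y, x))) ->
  reversible nu (mh_kernel k ma a01).
Proof.
move=> aF F mF F0.
have split_mh (G : E * E -> \bar R) :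
    measurable_fun setT G -> (forall p, 0 <= G p) ->
    \int[nu]_x \int[mh_kernel k ma a01 x]_y G (x, y) =
    \int[nu]_x \int[k x]_y ((a (x, y))%:E * G (x, y)) +
    \int[nu]_x ((1 - \int[k x]_y (a (x, y))%:E) * G (x, x)).
  move=> mG G0; rewrite -ge0_integralD//.
  - apply: eq_integral => x _.
    rewrite (@integral_mh_kernel _ _ _ _ _ _ _ _ (fun y => G (x, y)))//.
    exact: measurableT_comp.
  - by move=> x _; apply: integral_ge0 => y _; rewrite mule_ge0.
  - apply: (measurable_integral_kernel k (f := fun p => (a p)%:E * G p)).
      exact: emeasurable_funM.
    by move=> p; rewrite mule_ge0.
  - by move=> x _; rewrite mule_ge0.
  - apply: emeasurable_funM => //; apply: measurableT_comp => //.
    exact: measurable_fun_pair.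
have mF' : measurable_fun setT (fun p : E * E => F (p.2, p.1)).
  by apply: measurableT_comp => //; exact: measurable_fun_pair.
have F0' p : 0 <= F (p.2, p.1) by [].
by rewrite (split_mh F mF F0) (split_mh _ mF' F0') (aF F mF F0).
Qed.

End metropolis_hastings.

Section marginal.
Context d (X : measurableType d) (R : realType) (mu : probability X R).
Variables (q : R.-pker X ~> X) (r : X * X -> R).
Hypothesis hr : tierney_ratio mu q r.

Let r0 p : (0 <= r p)%R. Proof. exact: tierney_ratio_ge0 hr p. Qed.
Let mr : measurable_fun setT r. Proof. exact: tierney_ratio_measurable hr. Qed.

Lemma marginal_acc_ratio x y : (0 < r (x, y))%R -> (r (x, y) * r (y, x) = 1)%R ->
  marginal_acc r (x, y) = (r (x, y) * marginal_acc r (y, x))%R.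
Proof.
move=> rxy rr; rewrite /marginal_acc minr_pMr// ?ltW// mulr1 rr.
by rewrite minC.
Qed.

Lemma marginal_acc_eq0 p : r p = 0%R -> marginal_acc r p = 0%R.
Proof. by move=> rp; rewrite /marginal_acc rp min_r. Qed.

Lemma reversible_marginal : reversible mu (marginal_kernel hr).
Proof.
apply: reversible_mh_kernel => F mF F0.
have macc : measurable_fun setT (fun p => (marginal_acc r p)%:E).
  by apply/measurable_EFinP; exact: measurable_marginal_acc.
have acc0 p : 0 <= (marginal_acc r p)%:E.
  by rewrite lee_fin; case/andP: (marginal_acc01 r0 p).
apply: (@tierney_exchange _ _ _ _ _ _ (fun p => (marginal_acc r p)%:E * F p)
  (fun p => (marginal_acc r p)%:E * F (p.2, p.1)) hr).
- exact: emeasurable_funM.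
- by move=> p; rewrite mule_ge0.
- apply: emeasurable_funM => //; apply: measurableT_comp => //.
  exact: measurable_fun_pair.
- by move=> p; rewrite mule_ge0.
- by move=> p rp; rewrite marginal_acc_eq0// mul0e.
- by move=> p rp; rewrite marginal_acc_eq0// mul0e.
- by move=> x y rxy rr; rewrite (marginal_acc_ratio rxy rr) EFinM muleA.
Qed.

End marginal.

Section pseudo_marginal.
Context d (X : measurableType d) (R : realType) (mu : probability X R).
Variables (q : R.-pker X ~> X) (r : X * X -> R).
Hypothesis hr : tierney_ratio mu q r.
Variables (W : weight_set R) (Q : R.-pker X ~> weight W).
Hypothesis Q1 : forall x, \int[Q x]_w (wval w)%:E = 1.

Local Notation state := (X * weight W)%type.

Let r0 p : (0 <= r p)%R. Proof. exact: tierney_ratio_ge0 hr p. Qed.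
Let mr : measurable_fun setT r. Proof. exact: tierney_ratio_measurable hr. Qed.
Let mwval : measurable_fun setT (@wval R W). Proof. exact: measurable_wval. Qed.

(** The weight [w] of [pi_x(dw) = w Q_x(dw)] times the acceptance probability,
    symmetric up to the factor [r].  It vanishes at [w = 0] for every value of
    the acceptance probability there. *)
Definition joint_acc (x y : X) (w u : weight W) : R :=
  Num.min (wval w) (r (x, y) * wval u)%R.

Lemma joint_acc_ge0 x y w u : (0 <= joint_acc x y w u)%R.
Proof. by rewrite /joint_acc le_min wval_ge0 mulr_ge0// wval_ge0. Qed.

Lemma wval_pm_acc x y w u :
  (wval w * pm_acc r ((x, w), (y, u)) = joint_acc x y w u)%R.
Proof.
rewrite /pm_acc /joint_acc/=; case: eqP => [->|/eqP w0].
  by rewrite mul0r min_l// mulr_ge0// wval_ge0.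
by rewrite minr_pMr ?wval_ge0// mulr1 mulrCA [X in (_ * X)%R]mulrC divfK.
Qed.

Lemma joint_acc_ratio x y w u : (0 < r (x, y))%R -> (r (x, y) * r (y, x) = 1)%R ->
  joint_acc x y w u = (r (x, y) * joint_acc y x u w)%R.
Proof.
move=> rxy rr; rewrite /joint_acc minr_pMr ?ltW// mulrA rr mul1r.
by rewrite minC.
Qed.

(** What remains of an accepted move from [x] to [y] after averaging over the two
    weights. *)
Definition weight_average (F : state * state -> \bar R) (p : X * X) : \bar R :=
  \int[Q p.1]_w \int[Q p.2]_u
    ((joint_acc p.1 p.2 w u)%:E * F ((p.1, w), (p.2, u))).

Section weight_average.
Variable F : state * state -> \bar R.
Hypotheses (mF : measurable_fun setT F) (F0 : forall p, 0 <= F p).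

Let integrand_ge0 x y w u :
  0 <= (joint_acc x y w u)%:E * F ((x, w), (y, u)).
Proof. by rewrite mule_ge0// lee_fin joint_acc_ge0. Qed.

Let measurable_integrand : measurable_fun setT
  (fun t : (X * X * weight W) * weight W =>
    (joint_acc t.1.1.1 t.1.1.2 t.1.2 t.2)%:E *
    F ((t.1.1.1, t.1.2), (t.1.1.2, t.2))).
Proof.
have m1 : measurable_fun setT (fun t : (X * X * weight W) * weight W => t.1.1.1).
  by apply: measurableT_comp => //; exact: measurableT_comp.
have m2 : measurable_fun setT (fun t : (X * X * weight W) * weight W => t.1.1.2).
  by apply: measurableT_comp => //; exact: measurableT_comp.
have m3 : measurable_fun setT (fun t : (X * X * weight W) * weight W => t.1.2).
  exact: measurableT_comp.
apply: emeasurable_funM.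
- apply/measurable_EFinP; apply: measurable_minr.
    exact: measurableT_comp.
  apply: measurable_funM; last exact: measurableT_comp.
  by apply: measurableT_comp => //; exact: measurable_fun_pair.
- apply: measurableT_comp => //.
  by apply: measurable_fun_pair; exact: measurable_fun_pair.
Qed.

Let measurable_inner : measurable_fun setT (fun t : X * X * weight W =>
  \int[Q t.1.2]_u ((joint_acc t.1.1 t.1.2 t.2 u)%:E *
    F ((t.1.1, t.2), (t.1.2, u)))).
Proof.
apply: (measurable_integral_kernel_comp Q
  (h := fun t : X * X * weight W => t.1.2) _ measurable_integrand).
  exact: measurableT_comp.
by move=> t; exact: integrand_ge0.
Qed.

Lemma measurable_weight_average : measurable_fun setT (weight_average F).
Proof.
apply: (measurable_integral_kernel_comp Q
  (h := fun p : X * X => p.1) _ measurable_inner).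
  exact: measurable_fst.
by move=> t; apply: integral_ge0 => u _; exact: integrand_ge0.
Qed.

Lemma weight_average_ge0 p : 0 <= weight_average F p.
Proof.
by apply: integral_ge0 => w _; apply: integral_ge0 => u _; exact: integrand_ge0.
Qed.

(** The weight [w] is drawn before the proposal [y]; exchanging the two puts the
    integral in the form [mu(dx) q(x, dy)] to which [tierney_exchange] applies. *)
Lemma integral_pm_acc :
  \int[pm_target mu Q1]_z \int[pm_proposal q Q z]_z'
    ((pm_acc r (z, z'))%:E * F (z, z')) =
  \int[mu]_x \int[q x]_y weight_average F (x, y).
Proof.
have macc : measurable_fun setT (fun p => (pm_acc (W := W) r p)%:E).
  by apply/measurable_EFinP; exact: measurable_pm_acc.
have acc0 p : 0 <= (pm_acc (W := W) r p)%:E.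
  by rewrite lee_fin; case/andP: (pm_acc01 (W := W) r0 p).
pose aF (p : state * state) := (pm_acc r p)%:E * F p.
have maF : measurable_fun setT aF by exact: emeasurable_funM.
have aF0 p : 0 <= aF p by rewrite mule_ge0.
pose G (z : state) := \int[pm_proposal q Q z]_z' aF (z, z').
have mG : measurable_fun setT G.
  exact: (measurable_integral_kernel (pm_proposal q Q) maF aF0).
have G0 z : 0 <= G z by exact: integral_ge0.
have -> := integral_pjoint mu (weighted_kernel Q1) mG G0.
apply: eq_integral => x _.
have mGx : measurable_fun setT (fun w => G (x, w)).
  by apply: measurableT_comp => //; exact: measurable_fun_pair.
rewrite (integral_weighted Q1 x mGx (fun w => G0 (x, w))).
pose J (t : weight W * X) := \int[Q t.2]_u ((joint_acc x t.2 t.1 u)%:E *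
  F ((x, t.1), (t.2, u))).
have mJ : measurable_fun setT J.
  rewrite (_ : J = (fun t : X * X * weight W =>
    \int[Q t.1.2]_u ((joint_acc t.1.1 t.1.2 t.2 u)%:E *
      F ((t.1.1, t.2), (t.1.2, u)))) \o (fun t => (x, t.2, t.1)))//.
  apply: measurableT_comp; first exact: measurable_inner.
  by apply: measurable_fun_pair => //; exact: measurable_fun_pair.
have J0 t : 0 <= J t by apply: integral_ge0 => u _; exact: integrand_ge0.
transitivity (\int[Q x]_w \int[q x]_y J (w, y)).
  apply: eq_integral => w _.
  have maFz : measurable_fun setT (fun z' => aF ((x, w), z')).
    by apply: measurableT_comp => //; exact: measurable_fun_pair.
  have -> : G (x, w) = \int[q x]_y \int[Q y]_u aF ((x, w), (y, u)).
    exact: (integral_mjoint (q x) Q maFz (fun z' => aF0 ((x, w), z'))).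
  rewrite -ge0_integralZl_EFin//; last 3 first.
  - by move=> y _; exact: integral_ge0.
  - exact: (measurable_integral_kernel Q maFz (fun z' => aF0 ((x, w), z'))).
  - exact: wval_ge0.
  apply: eq_integral => y _; rewrite -ge0_integralZl_EFin//; last 2 first.
  - apply: (measurableT_comp maFz (g := fun u => (y, u))).
    exact: measurable_fun_pair.
  - exact: wval_ge0.
  by apply: eq_integral => u _; rewrite /aF muleA -EFinM wval_pm_acc.
exact: (sfinite_Fubini (kernel_at Q x) (kernel_at q x) J J0 mJ).
Qed.

End weight_average.

Lemma weight_average_swap (F : state * state -> \bar R) x y :
  measurable_fun setT F -> (forall p, 0 <= F p) ->
  (0 < r (x, y))%R -> (r (x, y) * r (y, x) = 1)%R ->
  weight_average F (x, y) =
  (r (x, y))%:E * weight_average (fun p => F (p.2, p.1)) (y, x).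
Proof.
move=> mF F0 rxy rr; rewrite /weight_average/=.
pose J (t : weight W * weight W) :=
  (joint_acc y x t.1 t.2)%:E * F ((x, t.2), (y, t.1)).
have J0 t : 0 <= J t by rewrite mule_ge0// lee_fin joint_acc_ge0.
have mJ : measurable_fun setT J.
  apply: emeasurable_funM; last first.
    apply: measurableT_comp => //.
    by apply: measurable_fun_pair; exact: measurable_fun_pair.
  apply/measurable_EFinP; apply: measurable_minr; first exact: measurableT_comp.
  by apply: measurable_funM => //; exact: measurableT_comp.
have -> : \int[Q y]_w \int[Q x]_u J (w, u) = \int[Q x]_u \int[Q y]_w J (w, u).
  exact: (sfinite_Fubini (kernel_at Q y) (kernel_at Q x) J J0 mJ).
have mJu u : measurable_fun setT (fun w => J (w, u)).
  by apply: measurableT_comp => //; exact: measurable_fun_pair.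
rewrite -ge0_integralZl_EFin//; last 2 first.
- by move=> u _; apply: integral_ge0 => w _.
- apply: (measurable_integral_kernel_comp Q (h := cst y)
    (f := fun t => J (t.2, t.1))) => //.
  by apply: measurableT_comp => //; exact: measurable_fun_pair.
apply: eq_integral => w _; rewrite -ge0_integralZl_EFin//.
apply: eq_integral => u _; rewrite /J/= muleA -EFinM.
by rewrite (joint_acc_ratio w u rxy rr).
Qed.

Lemma weight_average_eq0 (F : state * state -> \bar R) p :
  r p = 0%R -> weight_average F p = 0.
Proof.
case: p => x y rp; rewrite /weight_average/=.
apply: integral0_eq => w _; apply: integral0_eq => u _.
by rewrite /joint_acc rp mul0r min_r ?wval_ge0// mul0e.
Qed.

Lemma reversible_pseudo_marginal :
  reversible (pm_target mu Q1) (pseudo_marginal_kernel hr Q).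
Proof.
apply: reversible_mh_kernel => F mF F0.
have mF' : measurable_fun setT (fun p : state * state => F (p.2, p.1)).
  by apply: measurableT_comp => //; exact: measurable_fun_pair.
have F0' (p : state * state) : 0 <= F (p.2, p.1) by [].
have -> := integral_pm_acc mF F0; have -> := integral_pm_acc mF' F0'.
apply: (tierney_exchange hr).
- exact: measurable_weight_average.
- exact: weight_average_ge0.
- exact: measurable_weight_average.
- exact: weight_average_ge0.
- exact: weight_average_eq0.
- exact: weight_average_eq0.
- by move=> x y rxy rr; exact: weight_average_swap.
Qed.

(** Jensen's inequality for the concave function [(w, u) |-> min (w, r u)], whose
    arguments have mean 1: the mean of a minimum is at most the minimum of the
    means.  Noisy weights lower the acceptance rate between any two points. *)
Lemma weight_average_le x y (c : R) : (0 <= c)%R ->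
  weight_average (cst c%:E) (x, y) <= (marginal_acc r (x, y) * c)%:E.
Proof.
move=> c0; rewrite /weight_average/=.
have mv : measurable_fun setT (fun u : weight W => (wval u)%:E : \bar R).
  exact/measurable_EFinP.
have mj : measurable_fun setT
    (fun t : weight W * weight W => (joint_acc x y t.1 t.2)%:E * c%:E).
  apply: emeasurable_funM => //; apply/measurable_EFinP; apply: measurable_minr.
    exact: measurableT_comp.
  by apply: measurable_funM => //; exact: measurableT_comp.
have j0 w u : 0 <= (joint_acc x y w u)%:E * c%:E.
  by rewrite mule_ge0 ?lee_fin// joint_acc_ge0.
have mjw w : measurable_fun setT (fun u => (joint_acc x y w u)%:E * c%:E).
  exact: (measurableT_comp mj
    (measurable_fun_pair (measurable_cst w) (@measurable_id _ _ _))).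
have mij : measurable_fun setT
    (fun w => \int[Q y]_u ((joint_acc x y w u)%:E * c%:E)).
  exact: (measurable_integral_kernel_comp Q (measurable_cst y) mj).
have bound (b : weight W -> weight W -> R) (b' : weight W -> R) :
    (forall w u, 0 <= b w u)%R -> (forall w, measurable_fun setT (b w)) ->
    measurable_fun setT b' -> (forall w u, joint_acc x y w u <= b w u)%R ->
    (forall w, \int[Q y]_u (b w u)%:E = (b' w)%:E) ->
    \int[Q x]_w \int[Q y]_u ((joint_acc x y w u)%:E * c%:E) <=
    c%:E * \int[Q x]_w (b' w)%:E.
  move=> b0 mb mb' jb ib.
  have b'0 w : 0 <= (b' w)%:E.
    by rewrite -ib integral_ge0// => u _; rewrite lee_fin.
  have mb'E : measurable_fun setT (fun w => (b' w)%:E : \bar R).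
    exact/measurable_EFinP.
  rewrite -(ge0_integralZl_EFin _ measurableT (fun w _ => b'0 w) mb'E c0).
  apply: ge0_le_integral; [exact: measurableT| |exact: mij| |].
  - by move=> w _; apply: integral_ge0 => u _.
  - exact: measurable_funeM.
  - move=> w _; have mbE : measurable_fun setT (fun u => (b w u)%:E : \bar R).
      exact/measurable_EFinP.
    have b0E u : 0 <= (b w u)%:E by rewrite lee_fin.
    rewrite -ib -(ge0_integralZl_EFin _ measurableT (fun u _ => b0E u) mbE c0).
    apply: ge0_le_integral; [exact: measurableT| |exact: mjw| |].
    + by move=> u _; exact: j0.
    + exact: measurable_funeM.
    + by move=> u _; rewrite -!EFinM lee_fin [leRHS]mulrC ler_wpM2r.
rewrite /marginal_acc; have [_|_] := leP 1%R (r (x, y)).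
- apply: le_trans (bound (fun w _ => wval w) (@wval R W) _ _ _ _ _) _ => //.
  + by move=> w _; exact: wval_ge0.
  + by move=> w u; rewrite /joint_acc ge_min lexx.
  + by move=> w; rewrite integral_cst// prob_kernel mule1.
  + by rewrite Q1 mule1 mul1r.
- apply: le_trans (bound (fun _ u => r (x, y) * wval u)%R (cst (r (x, y)))
    _ _ _ _ _) _ => //.
  + by move=> w u; rewrite mulr_ge0// wval_ge0.
  + by move=> w; exact: measurable_funM.
  + by move=> w u; rewrite /joint_acc ge_min lexx orbT.
  + move=> w; under eq_integral do rewrite EFinM.
    rewrite ge0_integralZl_EFin// ?Q1 ?mule1// => u _.
    by rewrite lee_fin wval_ge0.
  + rewrite -[X in _ * X]/(\int[Q x]_w cst (r (x, y))%:E w).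
    by rewrite integral_cst// prob_kernel mule1 -EFinM mulrC.
Qed.

Section dirichlet_forms.
Variable g : X -> X -> R.
Hypotheses (mg : measurable_fun setT (fun p : X * X => g p.1 p.2))
  (g0 : forall x y, (0 <= g x y)%R).

Let mag : measurable_fun setT (fun p => (marginal_acc r p * g p.1 p.2)%:E).
Proof.
apply/measurable_EFinP; apply: measurable_funM => //.
exact: measurable_marginal_acc.
Qed.

Let ag0 p : 0 <= (marginal_acc r p * g p.1 p.2)%:E.
Proof. by rewrite lee_fin mulr_ge0//; case/andP: (marginal_acc01 r0 p). Qed.

(** Neither weight enters the integrand, and [pi_x] and [pi_y] are probabilities. *)
Lemma Delta_barE : Delta_bar mu q r Q1 g =
  \int[mu]_x \int[q x]_y (marginal_acc r (x, y) * g x y)%:E.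
Proof.
pose h p : \bar R := (marginal_acc r p * g p.1 p.2)%:E.
pose G x := \int[q x]_y h (x, y).
have mG : measurable_fun setT G by exact: (measurable_integral_kernel q mag ag0).
have G0 x : 0 <= G x by apply: integral_ge0 => y _; exact: ag0.
rewrite -[RHS](integral_pjoint_fst mu (weighted_kernel Q1) mG G0).
apply: eq_integral => -[x w] _ /=.
have mhx : measurable_fun setT (fun y => h (x, y)).
  by apply: measurableT_comp => //; exact: measurable_fun_pair.
exact: (integral_pjoint_fst (kernel_at q x) (weighted_kernel Q1) mhx
  (fun y => ag0 (x, y))).
Qed.

Lemma Delta_tilde_le : Delta_tilde mu q r Q1 g <= Delta_bar mu q r Q1 g.
Proof.
pose F (p : state * state) : \bar R := (g p.1.1 p.2.1)%:E.
have mF : measurable_fun setT F.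
  apply/measurable_EFinP.
  apply: (measurableT_comp mg (g := fun p : state * state => (p.1.1, p.2.1))).
  by apply: measurable_fun_pair; exact: measurableT_comp.
have F0 p : 0 <= F p by rewrite lee_fin.
rewrite Delta_barE.
have -> : Delta_tilde mu q r Q1 g =
    \int[mu]_x \int[q x]_y weight_average F (x, y).
  rewrite -(integral_pm_acc mF F0); apply: eq_integral => z _.
  by apply: eq_integral => z' _; rewrite EFinM.
have mwa := measurable_weight_average mF F0.
have wa0 := weight_average_ge0 F0.
apply: ge0_le_integral => //.
- by move=> x _; apply: integral_ge0 => y _; exact: wa0.
- exact: (measurable_integral_kernel q mwa wa0).
- exact: (measurable_integral_kernel q mag ag0).
- move=> x _; apply: ge0_le_integral => //.
  + by apply: measurableT_comp => //; exact: measurable_fun_pair.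
  + apply: (measurableT_comp mag (g := fun y => (x, y))).
    exact: measurable_fun_pair.
  + move=> y _; apply: le_trans (weight_average_le x y (g0 x y)).
    by rewrite /weight_average/=.
Qed.

End dirichlet_forms.

End pseudo_marginal.

(** * Asymptotic variance and Abel sums *)

Local Close Scope ereal_scope.

Section linear_bounds.
Variables (R : realType) (V : nat -> R).
Hypothesis V0 : V 0 = 0.
Hypothesis Vcvg : cvgn (fun n => (n%:R^-1 * V n)%:E).

(** The finitely many indices at which the quotient is still below [a] are absorbed
    in the constant [K]. *)
Lemma gt_limn_linear_bound (a : R) :
  (a%:E < limn (fun n => (n%:R^-1 * V n)%:E))%E ->
  exists K, forall n, a * n%:R - K <= V n.
Proof.
move=> aV; have [N _ NV] : \forall n \near \oo, (a%:E < (n%:R^-1 * V n)%:E)%E.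
  have aN := open_nbhs_nbhs (conj (@open_ereal_gt_ereal _ a%:E) aV).
  exact: Vcvg aN.
exists (\sum_(k < N) `|a * k%:R - V k|) => n.
have [nN|nN] := ltnP n N.
  rewrite lerBlDr -lerBlDl (bigD1 (Ordinal nN))//=.
  rewrite (le_trans (ler_norm _))// lerDl sumr_ge0//.
case: n nN => [|n] nN; first by rewrite V0 mulr0 sub0r oppr_le0 sumr_ge0.
rewrite lerBlDr (@le_trans _ _ (V n.+1))//; last by rewrite lerDl sumr_ge0.
have := NV n.+1 nN; rewrite /= lte_fin => /ltW.
by rewrite mulrC ler_pdivlMr.
Qed.

Lemma lt_limn_linear_bound (b : R) :
  (limn (fun n => (n%:R^-1 * V n)%:E) < b%:E)%E ->
  exists K, forall n, V n <= b * n%:R + K.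
Proof.
move=> bV; have [N _ NV] : \forall n \near \oo, ((n%:R^-1 * V n)%:E < b%:E)%E.
  have bN := open_nbhs_nbhs (conj (@open_ereal_lt_ereal _ b%:E) bV).
  exact: Vcvg bN.
exists (\sum_(k < N) `|V k - b * k%:R|) => n.
have [nN|nN] := ltnP n N.
  rewrite addrC -lerBlDr (bigD1 (Ordinal nN))//=.
  rewrite (le_trans (ler_norm _))// lerDl sumr_ge0//.
case: n nN => [|n] nN; first by rewrite V0 mulr0 add0r sumr_ge0.
rewrite (@le_trans _ _ (b * n.+1%:R))//; last by rewrite lerDl sumr_ge0.
have := NV n.+1 nN; rewrite /= lte_fin => /ltW.
by rewrite mulrC ler_pdivrMr.
Qed.

End linear_bounds.

Lemma lee_add_of_lt (R : realType) (x y : \bar R) (b : R) :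
  (0 <= x)%E -> (0 <= y)%E ->
  (forall a c : R, (a%:E < x)%E -> (c%:E < y)%E -> a + c <= b) ->
  (x + y <= b%:E)%E.
Proof.
case: x => [x| |]//; case: y => [y| |]// x0 y0 H.
- apply/lee_addgt0Pr => e e0; rewrite -!EFinD lee_fin.
  have e2 : 0 < e / 2 by rewrite divr_gt0.
  have := H (x - e / 2) (y - e / 2); rewrite !lte_fin !gtrBl => /(_ e2 e2).
  lra.
- have := H (x - 1) (b - x + 2); rewrite lte_fin gtrBl ltr01 ltry.
  by move=> /(_ isT isT) bx; exfalso; clear x0 y0 H; lra.
- have := H (b - y + 2) (y - 1); rewrite lte_fin gtrBl ltr01 ltry.
  by move=> /(_ isT isT) bx; exfalso; clear x0 y0 H; lra.
- have := H (b + 1) 0; rewrite !ltry => /(_ isT isT) bx.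
  by exfalso; clear x0 y0 H; lra.
Qed.

Section variance_of_reversible_kernel.
Context d (E : measurableType d) (R : realType).
Variables (nu : probability E R) (K : R.-pker E ~> E) (f : E -> R).
Hypotheses (rev : reversible nu K) (f2 : L2 nu f).

Let e := orbit K f (\int[nu]_x f x).
Let c := autocov nu e.

Let e2 k : L2 nu (e k). Proof. exact: L2_orbit. Qed.

Let eS k h : L2 nu h -> step_form nu K (e k) h = ip nu (e k.+1) h.
Proof. exact: step_form_orbit. Qed.

Lemma asymptotic_varianceE : asymptotic_variance K nu f =
  limn (fun n => (n%:R^-1 * partial_variance c n)%:E).
Proof.
rewrite /asymptotic_variance; congr (limn _); apply/funext => n.
by rewrite integral_path_expectation// EFinM.
Qed.

Let cvgV : cvgn (fun n => (n%:R^-1 * partial_variance c n)%:E).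
Proof.
exact: (cvg_partial_variance (normr_autocov_le rev e2 eS)
  (autocov_pair_ge0 rev e2 eS)).
Qed.

Lemma asymptotic_variance_ge0 : (0 <= asymptotic_variance K nu f)%E.
Proof.
rewrite asymptotic_varianceE; apply: lime_ge; first exact: cvgV.
apply: nearW => n; rewrite EFinM mule_ge0 ?lee_fin ?invr_ge0//.
rewrite -lee_fin -(integral_path_expectation rev _ f2 n).
apply: integral_ge0 => x _; apply: path_expectation_ge0 => s.
by rewrite lee_fin sqr_ge0.
Qed.

Lemma lt_asymptotic_variance a : (a%:E < asymptotic_variance K nu f)%E ->
  exists B, forall l, 0 < l < 1 -> a - (1 - l) * B <= 2 * abel_sum c l - c 0.
Proof.
rewrite asymptotic_varianceE => /(gt_limn_linear_bound (partial_variance0 c) cvgV).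
move=> [B HB]; exists B => l l01.
exact: (abel_sum_ge (normr_autocov_le rev e2 eS) l01 HB).
Qed.

Lemma gt_asymptotic_variance b : (asymptotic_variance K nu f < b%:E)%E ->
  exists B, forall l, 0 < l < 1 -> 2 * abel_sum c l - c 0 <= b + (1 - l) * B.
Proof.
rewrite asymptotic_varianceE => /(lt_limn_linear_bound (partial_variance0 c) cvgV).
move=> [B HB]; exists B => l l01.
exact: (abel_sum_le (normr_autocov_le rev e2 eS) l01 HB).
Qed.

End variance_of_reversible_kernel.

Lemma measurable_sqr_diff d (X : measurableType d) (R : realType) (p : X -> R) :
  measurable_fun setT p ->
  measurable_fun setT (fun z : X * X => (p z.1 - p z.2) ^+ 2).
Proof.
move=> mp; apply: measurable_funX.
by apply: measurable_funB; exact: measurableT_comp.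
Qed.

Section comparison.
Context (R : realType) (d : measure_display) (X : measurableType d).
Variables (mu : probability X R) (q : R.-pker X ~> X).
Variables (r : X * X -> R) (hr : tierney_ratio mu q r).
Variables (W : weight_set R) (Q : R.-pker X ~> weight W).
Hypothesis Q1 : forall x : X, (\int[Q x]_w (wval w)%:E = 1)%E.
Variable f : X -> R.
Hypothesis f2 : L2 mu f.

Let P := marginal_kernel hr.
Let Pt := pseudo_marginal_kernel hr Q.
Let nut : probability (X * weight W)%type R := pm_target mu Q1.
Let ft (z : X * weight W) := f z.1.
Let m := \int[mu]_x f x.
Let mt := \int[nut]_z ft z.
Let c := autocov mu (orbit P f m).
Let ct := autocov nut (orbit Pt ft mt).

Let revP : reversible mu P. Proof. exact: reversible_marginal. Qed.
Let revPt : reversible nut Pt. Proof. exact: reversible_pseudo_marginal. Qed.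

Let fstE (F : X -> \bar R) : measurable_fun setT F -> (forall x, 0 <= F x)%E ->
  (\int[nut]_z F z.1 = \int[mu]_x F x)%E.
Proof. exact: integral_pjoint_fst. Qed.

Let L2t (g : X -> R) : L2 mu g -> L2 nut (fun z => g z.1).
Proof.
by move=> g2; exact: (L2_comp (@measurable_fst _ _ X (weight W)) fstE g2).
Qed.

Let ipt (g h : X -> R) : L2 mu g -> L2 mu h ->
  ip nut (fun z => g z.1) (fun z => h z.1) = ip mu g h.
Proof. by move=> [mg _] [mh _]; exact: (ip_comp fstE mg mh). Qed.

Let mtE : mt = m.
Proof. by have [mf _] := f2; exact: (Rintegral_comp fstE mf). Qed.

Let orbit0E : orbit Pt ft mt 0 = (fun z => orbit P f m 0 z.1).
Proof. by rewrite mtE. Qed.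

Lemma autocov0E : ct 0 = c 0.
Proof.
by rewrite /ct /autocov orbit0E ipt//; exact: L2_orbit.
Qed.

(** The resolvent [phi] of [P] attains the supremum that gives the Abel sum of [P],
    and lifted to weighted states it is a trial function for the Abel sum of the
    pseudo-marginal kernel.  The two variational expressions have the same linear
    part and differ by the Dirichlet forms of [phi], which are [Delta_bar] and
    [Delta_tilde] at [g]. *)
Lemma asymptotic_variance_abel_gap l : 0 < l < 1 ->
  let phi := resolvent_sum P mu f l in
  let g := fun x y => (phi x - phi y) ^+ 2 in
  exists D : R, [/\ 0 <= D,
    (Delta_bar mu q r Q1 g - Delta_tilde mu q r Q1 g = D%:E)%E &
    2 * abel_sum c l - c 0 + l * D <= 2 * abel_sum ct l - ct 0].
Proof.
move=> l01 phi g.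
have e2 k : L2 mu (orbit P f m k) by exact: L2_orbit.
have eS k h : L2 mu h ->
    step_form mu P (orbit P f m k) h = ip mu (orbit P f m k.+1) h.
  by move=> h2; exact: step_form_orbit.
have et2 k : L2 nut (orbit Pt ft mt k) by apply: L2_orbit => //; exact: L2t.
have etS k h : L2 nut h ->
    step_form nut Pt (orbit Pt ft mt k) h = ip nut (orbit Pt ft mt k.+1) h.
  by move=> h2; apply: step_form_orbit => //; exact: L2t.
have phi2 : L2 mu phi := L2_resolvent revP e2 eS l01.
have phit2 : L2 nut (fun z => phi z.1) := L2t phi2.
have [mphi _] := phi2; have [mphit _] := phit2.
have mg := measurable_sqr_diff mphi.
have g0 x y : 0 <= g x y by exact: sqr_ge0.
pose D1 := 2 * (ip mu phi phi - step_form mu P phi phi).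
pose D2 := 2 *
  (ip mu phi phi - step_form nut Pt (fun z => phi z.1) (fun z => phi z.1)).
have DbE : Delta_bar mu q r Q1 g = D1%:E.
  rewrite -dirichletE// (Delta_barE hr Q1 mg g0).
  by rewrite /P /marginal_kernel dirichlet_mh_kernel.
have DtE : Delta_tilde mu q r Q1 g = D2%:E.
  rewrite /D2 -(ipt phi2 phi2) -(dirichletE revPt phit2).
  by rewrite /Pt /pseudo_marginal_kernel dirichlet_mh_kernel.
exists (D1 - D2); split.
- by rewrite subr_ge0 -lee_fin -DbE -DtE; exact: (Delta_tilde_le hr Q1 mg g0).
- by rewrite DbE DtE.
- have := abel_sum_le_resolvent revP e2 eS l01.
  have := abel_sum_ge_variational revPt et2 etS l01 phit2.
  rewrite orbit0E ipt// -/c -/ct autocov0E /resolvent_form ipt//.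
  rewrite -[resolvent _ _]/phi /D1 /D2 => H1 H2.
  lra.
Qed.

End comparison.

(** * The limit of Abel means *)

Local Open Scope ereal_scope.

Lemma at_left_unit_interval (R : realType) :
  \forall l \near (1%R : R)^'-, (0 < l < 1)%R.
Proof.
near=> l; apply/andP; split.
  by near: l; exact: nbhs_left_gt.
by near: l; exact: nbhs_left_lt.
Unshelve. all: by end_near. Qed.

Lemma limf_einf_ge0 (R : realType) (D : R -> \bar R) :
  (forall l, (0 < l < 1)%R -> 0 <= D l) -> 0 <= limf_einf D (1%R : R)^'-.
Proof.
move=> D0; rewrite limf_einfE.
apply: (@le_trans _ _ (ereal_inf (D @` [set l | (0 < l < 1)%R]))).
  by apply: le_ereal_inf_tmp => _ [l l01 <-]; exact: D0.
apply: ereal_sup_ubound; exists [set l | (0 < l < 1)%R] => //.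
exact: at_left_unit_interval.
Qed.

Lemma lt_limf_einf (R : realType) (D : R -> \bar R) (c : \bar R) :
  c < limf_einf D (1%R : R)^'- -> \forall l \near (1%R : R)^'-, c < D l.
Proof.
rewrite limf_einfE => /ereal_sup_gt[_ [V V1 <-]] cV.
apply: filterS V1 => l Vl; apply: lt_le_trans cV _.
by apply: ereal_inf_lbound; exists l.
Qed.

Theorem theorem7 (R : realType) (d : measure_display) (X : measurableType d)
    (mu : probability X R) (q : R.-pker X ~> X)
    (r : X * X -> R) (hr : tierney_ratio mu q r)
    (W : weight_set R) (Q : R.-pker X ~> weight W)
    (Q1 : forall x : X, \int[Q x]_w (wval w)%:E = 1)
    (f : X -> R) (mf : measurable_fun setT f)
    (f2 : \int[mu]_x ((f x ^+ 2)%R)%:E < +oo) :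
  let P := marginal_kernel hr in
  let Pt := pseudo_marginal_kernel hr Q in
  let var_P := asymptotic_variance P mu f in
  let var_Pt := asymptotic_variance Pt (pm_target mu Q1)
                  (fun z : X * weight W => f z.1) in
  let phi := resolvent_sum P mu f in
  let g := fun (l : R) (x y : X) => ((phi l x - phi l y) ^+ 2)%R in
  var_P <= var_Pt /\
  var_P + limf_einf (fun l : R => Delta_bar mu q r Q1 (g l)
                                  - Delta_tilde mu q r Q1 (g l)) (1%R : R)^'-
    <= var_Pt.
Proof.
move=> P Pt vP vPt phi g.
pose nut : probability (X * weight W)%type R := pm_target mu Q1.
have f2L : L2 mu f by [].
have ft2L : L2 nut (fun z => f z.1).
  exact: (L2_comp (@measurable_fst _ _ X (weight W))
    (integral_pjoint_fst mu (weighted_kernel Q1)) f2L).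
have revP : reversible mu P := reversible_marginal hr.
have revPt : reversible nut Pt := reversible_pseudo_marginal hr Q1.
have gap := asymptotic_variance_abel_gap hr Q1 f2L.
set D := fun l => _; set L := limf_einf D _.
have L0 : 0 <= L.
  apply: limf_einf_ge0 => l l01; have [D' [D'0 DE _]] := gap l l01.
  by rewrite /D DE lee_fin.
have vP0 : 0 <= vP := asymptotic_variance_ge0 revP f2L.
suff vPL : vP + L <= vPt.
  by split => //; apply: le_trans vPL; rewrite leeDl.
have := asymptotic_variance_ge0 revPt ft2L; rewrite -/vPt.
case E : vPt => [b| |]// _; last by rewrite leey.
apply: lee_add_of_lt => // a c avP cL.
apply/ler_addgt0Pr => e e0.
have [B1 HB1] := lt_asymptotic_variance revP f2L avP.
have : vPt < (b + e / 2)%:E by rewrite E lte_fin ltrDl divr_gt0.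
move=> /(gt_asymptotic_variance revPt ft2L)[B2 HB2].
(* the error terms will add up to at most (1 - l) * s *)
pose s : R := (`|B1| + `|B2| + `|c| + 1)%R.
have s0 : (0 < s)%R by rewrite ltr_wpDl// !addr_ge0.
have near1 : \forall l \near (1%R : R)^'-, (1 - e / 2 / s < l)%R.
  by apply: nbhs_left_gt; rewrite gtrBl !divr_gt0.
have [l [[l01 cD] ls]] : exists l,
    ((0 < l < 1)%R /\ c%:E < D l) /\ (1 - e / 2 / s < l)%R.
  apply: (@filter_ex _ (1%R : R)^'-).
  apply: filterI near1; apply: filterI (lt_limf_einf cL).
  exact: at_left_unit_interval.
have [D' [D'0 DE main]] := gap l l01.
move: cD; rewrite /D DE lte_fin => cD.
have := HB1 l l01; have := HB2 l l01.
have /andP[l0 l1] := l01.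
have ls' : ((1 - l) * s < e / 2)%R by rewrite -ltr_pdivlMr//; lra.
have lc : (l * c <= l * D')%R by rewrite ler_pM2l// ltW.
have : ((1 - l) * (B1 + B2 + c) <= (1 - l) * s)%R.
  rewrite ler_wpM2l ?subr_ge0 ?(ltW l1)// /s.
  have := ler_norm B1; have := ler_norm B2; have := ler_norm c; lra.
move: main; set v1 := (2 * _ - _)%R; set v2 := (2 * _ - _)%R.
clear -lc ls'; nra.
Qed.
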